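(* Let $d\ge1$, $D>0$, $\sigma\ge0$, $\alpha\in[0,1)$, $\rho>0$, and let $T$ be an even positive integer. Let $w^*\in\mathbb{R}^d$ with $\|w^*\|\le D$, and let $(x,\epsilon,b)$ be mutually independent random variables with $x\in\mathbb{R}^d$, $\|x\|\le1$ a.s., $\Sigma:=\mathbb{E}[(x-\mathbb{E}x)(x-\mathbb{E}x)^T]\succeq\rho I$, $\epsilon\in\mathbb{R}$, $|\epsilon|\le\sigma$ a.s., $\mathbb{E}\epsilon=0$, $b\in\mathbb{R}$, $\mathbb{P}(b\ne0)=\alpha$; set $y=\langle w^*,x\rangle+\epsilon+b$. Let $R=6D+\sigma$, $\lambda=(1-\alpha)\rho$, and let $\bar w$ be the output of the following algorithm, which uses $2T$ i.i.d. samples distributed as $(x,y)$: Phase 1: draw $T$ samples $(z_i,y_i)_{i=1}^T$ and set $\mu=\frac1T\sum_{i=1}^Tz_i$. Phase 2: set $w_1=0$; for $t=1,\dots,T$ draw a fresh sample $(x_t,y_t)$, set $\eta_t=\frac1{\lambda t}$, $g_t=\phi_R(\langle w_t,x_t-\mu\rangle-y_t)(x_t-\mu)$, $w_{t+1}=\Pi_{\mathcal W}(w_t-\eta_tg_t)$; output $\bar w=\frac2T\sum_{t=T/2+1}^Tw_t$. Then $$\mathbb{E}\|\bar w-w^*\|^2\le\frac{72R^2(2\log T+1)}{((1-\alpha)\rho)^2\,T}.$$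
   Context: $\mathcal W=\{w\in\mathbb{R}^d:\|w\|\le D\}$, $\Pi_{\mathcal W}$ is the Euclidean projection onto $\mathcal W$, and $\phi_R(s)=\min\{R,\max\{s,-R\}\}$ (the derivative of the Huber loss $h_R(s)=\frac12s^2$ for $|s|\le R$, $R(|s|-\frac12R)$ otherwise). The expectation is over all $2T$ samples. *)

(* Defs.v *)
From HB Require Import structures.
From mathcomp Require Import all_boot all_order all_algebra.
From mathcomp Require Import all_classical all_reals all_analysis.
Set Implicit Arguments. Unset Strict Implicit. Unset Printing Implicit Defensive.
Import Order.TTheory GRing.Theory Num.Theory.
Local Open Scope classical_set_scope.
Local Open Scope ring_scope.

Section Defs.
Context {R : realType} {d : nat}.

Definition dotv (u v : 'rV[R]_d) : R := \sum_(k < d) u 0 k * v 0 k.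
Definition norm2 (v : 'rV[R]_d) : R := Num.sqrt (dotv v v).

Definition phiR (Rr s : R) : R := Num.min Rr (Num.max s (- Rr)).

Definition projW (D : R) (w : 'rV[R]_d) : 'rV[R]_d :=
  if norm2 w <= D then w else (D / norm2 w) *: w.

Definition phase1_mean (T : nat) (z : nat -> 'rV[R]_d) : 'rV[R]_d :=
  (T%:R)^-1 *: \sum_(i < T) z i.

(* Phase 2 iterates: wseq k = w_{k+1}; w_1 = 0 and the step t = k+1 uses the
   fresh sample (xs k, ys k) (phase-2 samples indexed from 0). *)
Fixpoint wseq (D Rr lam : R) (mu : 'rV[R]_d) (xs : nat -> 'rV[R]_d)
    (ys : nat -> R) (k : nat) : 'rV[R]_d :=
  match k with
  | 0 => 0
  | k'.+1 =>
      let w := wseq D Rr lam mu xs ys k' in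
      let eta := (lam * (k'.+1)%:R)^-1 in
      let g := phiR Rr (dotv w (xs k' - mu) - ys k') *: (xs k' - mu) in
      projW D (w - eta *: g)
  end.

(* Output: wbar = (2/T) sum_{t=T/2+1}^T w_t = (2/T) sum_{k=T/2}^{T-1} wseq k *)
Definition wbar (D Rr lam : R) (T : nat) (z : nat -> 'rV[R]_d)
    (xs : nat -> 'rV[R]_d) (ys : nat -> R) : 'rV[R]_d :=
  (2 / T%:R) *: \sum_(T./2 <= k < T)
     wseq D Rr lam (phase1_mean T z) xs ys k.

End Defs.

Section Prob.
Context {dm : measure_display} {Omega : measurableType dm} {R : realType}.

Definition gen_sigma (fs : set (Omega -> R)) : set (set Omega) :=
  <<s [set f @^-1` A | f in fs & A in [set A : set R | measurable A]] >>.

Definition mutually_independent {I : eqType} (P : probability Omega R)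
    (J0 : pred I) (G : I -> set (set Omega)) : Prop :=
  forall (J : seq I) (E : I -> set Omega),
    uniq J -> all J0 J -> (forall j, j \in J -> G j (E j)) ->
    P (\big[setI/setT]_(j <- J) E j) = (\prod_(j <- J) fine (P (E j)))%:E.

(* two R^d-valued random vectors (given by coordinates) have the same law:
   equality on all measurable boxes (a pi-system generating Borel(R^d)) *)
Definition same_law_vec {d : nat} (P : probability Omega R)
    (X Y : Omega -> 'rV[R]_d) : Prop :=
  forall A : 'I_d -> set R, (forall k, measurable (A k)) ->
    P (\big[setI/setT]_(k < d) ((fun w => X w 0 k) @^-1` A k)) =
    P (\big[setI/setT]_(k < d) ((fun w => Y w 0 k) @^-1` A k)).

Definition same_law (P : probability Omega R) (X Y : Omega -> R) : Prop :=
  forall A : set R, measurable A -> P (X @^-1` A) = P (Y @^-1` A).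

End Prob.

(* Main.v *)
(* Write v = w_t - w*, delta = E x - mu, u = <v, x_t - mu> and
   e = <w*, mu> + eps + b, so that g_t = phi_R(u - e)(x_t - mu).  Since phi_R is
   nondecreasing, phi_R(u - e) u >= phi_R(-e) u, and when b = 0 both arguments lie
   in [-R, R], which adds u^2 on the right.  Conditionally on the past, the part of
   phi_R(-e) u linear in x_t - E x averages to zero because x_t is independent of
   (eps_t, b_t), so E<g_t, v> >= (1 - alpha) rho E|v|^2 - R E(|v| |delta|).  With
   E|delta|^2 <= 1/T and AM-GM, a_t = E|w_t - w*|^2 satisfies
     a_{t+1} <= (1 - 1/t) a_t + c/(tT) + 4c/t^2,   c = R^2/lambda^2,
   hence a_{t+1} <= c/T + 4 c H_t / t with H_t the harmonic number, and convexity of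
   the squared norm bounds the suffix average. *)
Require Import Defs.
From HB Require Import structures.
From mathcomp Require Import all_boot all_order all_algebra.
From mathcomp Require Import all_classical all_reals all_analysis.
From mathcomp Require Import measurable_realfun ring lra.
Import Order.TTheory GRing.Theory Num.Theory.
Local Open Scope classical_set_scope.
Local Open Scope ring_scope.

(** * Independence of generated sigma-algebras *)

(** No conditional expectation is ever formed. Each sample is split into three components, and
    averaging over [x_t] given the past becomes the product rule E[fg] = E[f] E[g] for bounded [f],
    [g] that read disjoint sets of (sample, component) indices. The weight phi_R(-e) reads phase 1
    and the noise of the current sample, but not its covariate; this is why the linear part vanishes
    however adversarial the law of [b] is. What survives is the bias <v, delta>. AM-GM charges it
    lam |v|^2, half of the contraction 2 lam |v|^2 coming from clean samples. The other half leaves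
    the factor 1 - 1/t, which multiplication by t turns into a telescoping sum; the remaining cost
    c/(tT) stays of order 1/T because phase 1 spends T samples on the mean. No moment of [b] is
    assumed. It enters only through the clipping and the indicator of [b = 0], so once [x] and [eps]
    are truncated every integrand is bounded everywhere and integrability is automatic. *)

Section Independence.
Context {dm : measure_display} {Omega : measurableType dm} {R : realType}
  (P : probability Omega R).

(** With [B] fixed, both sides are finite measures in [A]; agreeing on a pi-system that contains
    [setT], they agree on the generated sigma-algebra. *)
Lemma indep_pi_system_l (C : set (set Omega)) (B : set Omega) :
  C `<=` measurable -> setI_closed C -> C setT -> measurable B ->
  (forall A, C A -> P (A `&` B) = (P A * P B)%E) ->
  forall A, <<s C >> A -> P (A `&` B) = (P A * P B)%E.
Proof.
move=> Cm CI CT mB CB.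
have PB0 : (0 <= fine (P B))%R by rewrite fine_ge0.
have PBE : P B = (NngNum PB0)%:num%:E by rewrite /= fineK// fin_num_measure.
pose m1 : {measure set Omega -> \bar R} := mrestr P mB.
pose m2 : {measure set Omega -> \bar R} := mscale (NngNum PB0) P.
have m2E A : m2 A = (P A * P B)%E by rewrite [RHS]muleC [in RHS]PBE.
move=> A sA; rewrite -m2E -[LHS]/(m1 A).
apply: (g_sigma_algebra_measure_unique C Cm (fun=> setT)) => //.
- by rewrite bigcup_const.
- by move=> X /CB PX; rewrite m2E -PX.
- by move=> _; rewrite /m1 /= /mrestr (le_lt_trans (probability_le1 _ _)) ?ltry//;
    exact: measurableI.
Qed.

(** The one-sided extension is applied twice: first in [A] with [B] already in the large
    sigma-algebra, then in [B] with [A] a generator. *)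
Lemma indep_pi_system (C1 C2 : set (set Omega)) :
  C1 `<=` measurable -> setI_closed C1 -> C1 setT ->
  C2 `<=` measurable -> setI_closed C2 -> C2 setT ->
  (forall A B, C1 A -> C2 B -> P (A `&` B) = (P A * P B)%E) ->
  forall A B, <<s C1 >> A -> <<s C2 >> B -> P (A `&` B) = (P A * P B)%E.
Proof.
move=> m1 I1 T1 m2 I2 T2 C12 A B sA sB.
have sub2 : <<s C2 >> `<=` measurable.
  by apply: smallest_sub => //; exact: sigma_algebra_measurable.
apply: (indep_pi_system_l C1) => //; first exact: sub2.
move=> {sA}A C1A; rewrite setIC muleC.
apply: (indep_pi_system_l C2) => //; first exact: m1.
by move=> {sB}B C2B; rewrite setIC muleC; exact: C12.
Qed.

Context {I : eqType} (J0 : pred I) (G : I -> set (set Omega)).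
Hypothesis Gsigma : forall j, J0 j -> sigma_algebra setT (G j).
Hypothesis Gmeas : forall j, J0 j -> G j `<=` measurable.
Hypothesis Gindep : mutually_independent P J0 G.

Definition family_union (S : pred I) : set (set Omega) :=
  [set A | exists2 j, S j & G j A].

(** [family_union S] need not be closed under intersection. Finite intersections with one event per
    distinct index form a pi-system containing it, and mutual independence speaks about exactly
    these sets. *)
Let cyl (S : pred I) : set (set Omega) :=
  [set A | exists J E, [/\ uniq J, all S J, (forall j, j \in J -> G j (E j)) &
    A = \big[setI/setT]_(j <- J) E j]].

Let bigsetI_mask (J K : seq I) (E : I -> set Omega) : uniq J -> uniq K ->
  {subset K <= J} -> \big[setI/setT]_(j <- J) (if j \in K then E j else setT) =
  \big[setI/setT]_(j <- K) E j.
Proof.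
move=> uJ uK KJ; rewrite -big_mkcond -big_filter; apply: perm_big.
apply: uniq_perm => //; first exact: filter_uniq.
move=> j; rewrite mem_filter; case: (boolP (j \in K)) => //= /KJ ->//.
Qed.

Let GT j : J0 j -> G j setT.
Proof.
move=> /Gsigma [G0 GC _]; rewrite -[setT]setD0; exact: GC.
Qed.

Let GI j : J0 j -> setI_closed (G j).
Proof.
move=> /Gsigma Gs A B GA GB.
have := @sigma_algebra_id _ setT (G j) Gs => <-.
by apply: (@measurableI _ (g_sigma_algebraType (G j))); exact: sub_sigma_algebra.
Qed.

Let cylI (S : pred I) : {subset S <= J0} -> setI_closed (cyl S).
Proof.
move=> SJ0 A B [J [E [uJ SJ GE ->]]] [K [F [uK SK GF ->]]].
(* An index occurring on one side only is padded with [setT], so that both intersections run over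
   one duplicate-free list. *)
exists (undup (J ++ K)), (fun j => (if j \in J then E j else setT) `&`
  (if j \in K then F j else setT)); split.
- exact: undup_uniq.
- by apply/allP => j; rewrite mem_undup mem_cat => /orP[/(allP SJ)|/(allP SK)].
- move=> j; rewrite mem_undup mem_cat => jJK.
  have J0j : J0 j.
    by apply: SJ0; case/orP : jJK => [/(allP SJ)|/(allP SK)].
  by apply: GI => //; case: ifPn => ?; [exact: GE|exact: GT|exact: GF|exact: GT].
- rewrite big_split/= !bigsetI_mask ?undup_uniq// => j jJ;
    by rewrite mem_undup mem_cat jJ ?orbT.
Qed.

Let cyl_meas (S : pred I) : {subset S <= J0} -> cyl S `<=` measurable.
Proof.
move=> SJ0 A [J [E [uJ SJ GE ->]]]; rewrite big_seq.
apply: big_ind => //; first exact: measurableI.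
by move=> j jJ; apply: (Gmeas j); [apply: SJ0; exact: (allP SJ)|exact: GE].
Qed.

Let cylT (S : pred I) : cyl S setT.
Proof. by exists [::], (fun=> setT); split => //; rewrite big_nil. Qed.

Let indep_cyl (S1 S2 : pred I) A B :
  {subset S1 <= J0} -> {subset S2 <= J0} -> (forall j, S1 j -> ~~ S2 j) ->
  cyl S1 A -> cyl S2 B -> P (A `&` B) = (P A * P B)%E.
Proof.
move=> S1J S2J S12 [J [E [uJ SJ GE ->]]] [K [F [uK SK GF ->]]].
(* [J] and [K] are disjoint, so the two choices of events merge into one family and mutual
   independence applies to [J], [K] and [J ++ K] alike. *)
pose H j := if j \in J then E j else F j.
have KJ j : j \in K -> j \notin J.
  move=> jK; apply/negP => /(allP SJ) /S12; by rewrite (allP SK _ jK).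
have EH : \big[setI/setT]_(j <- J) E j = \big[setI/setT]_(j <- J) H j.
  by rewrite big_seq [RHS]big_seq; apply: eq_bigr => j jJ; rewrite /H jJ.
have FH : \big[setI/setT]_(j <- K) F j = \big[setI/setT]_(j <- K) H j.
  rewrite big_seq [RHS]big_seq; apply: eq_bigr => j jJ.
  by rewrite /H (negbTE (KJ _ jJ)).
have J0J : all J0 J by apply/allP => j /(allP SJ); exact: S1J.
have J0K : all J0 K by apply/allP => j /(allP SK); exact: S2J.
have GH1 j : j \in J -> G j (H j) by move=> jJ; rewrite /H jJ; exact: GE.
have GH2 j : j \in K -> G j (H j).
  by move=> jK; rewrite /H (negbTE (KJ _ jK)); exact: GF.
rewrite EH FH -big_cat/= (Gindep (J ++ K)) ?(Gindep J) ?(Gindep K)//.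
- by rewrite big_cat/= EFinM.
- rewrite cat_uniq uJ uK andbT /=; apply/hasPn => j; exact: KJ.
- by rewrite all_cat J0J.
- by move=> j; rewrite mem_cat => /orP[/GH1|/GH2].
Qed.

Let sub_cyl (S : pred I) : {subset S <= J0} ->
  <<s family_union S >> `<=` <<s cyl S >>.
Proof.
move=> SJ0; apply: smallest_sub; first exact: smallest_sigma_algebra.
move=> A [j Sj GA]; apply: sub_sigma_algebra.
by exists [:: j], (fun=> A); split => //=; rewrite ?Sj ?big_seq1// => k /[!inE] /eqP ->.
Qed.

(** Grouping lemma: disjoint blocks of a mutually independent family generate independent
    sigma-algebras. *)
Lemma indep_family_union (S1 S2 : pred I) A B :
  {subset S1 <= J0} -> {subset S2 <= J0} -> (forall j, S1 j -> ~~ S2 j) ->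
  <<s family_union S1 >> A -> <<s family_union S2 >> B ->
  P (A `&` B) = (P A * P B)%E.
Proof.
move=> S1J S2J S12 /(sub_cyl _ S1J) sA /(sub_cyl _ S2J) sB.
apply: (indep_pi_system (cyl S1) (cyl S2)) => //;
  [exact: cyl_meas|exact: cylI|exact: cyl_meas|exact: cylI|].
by move=> X Y; exact: indep_cyl.
Qed.

Lemma family_union_meas (S : pred I) : {subset S <= J0} ->
  <<s family_union S >> `<=` measurable.
Proof.
move=> SJ0; apply: smallest_sub; first exact: sigma_algebra_measurable.
by move=> A [j /SJ0/Gmeas]; exact.
Qed.

End Independence.

(** * Bounded functions measurable for a sub-sigma-algebra, and the product rule *)

Section BoundedMeasurable.
Context {dm : measure_display} {Omega : measurableType dm} {R : realType}
  (P : probability Omega R).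

(** [C] records which information [f] reads. The bound holds everywhere rather than almost
    everywhere, which makes the class stable under ring operations and free of integrability
    conditions. *)
Definition bounded_mfun (C : set (set Omega)) (f : Omega -> R) : Prop :=
  @measurable_fun _ _ (g_sigma_algebraType C) R setT f /\
  exists M, forall w, `|f w| <= M.

Implicit Types (C : set (set Omega)) (f g : Omega -> R).

Lemma bounded_mfun_cst C r : bounded_mfun C (fun=> r).
Proof. by split; [exact: measurable_cst|exists `|r|]. Qed.

Lemma bounded_mfunD C f g : bounded_mfun C f -> bounded_mfun C g ->
  bounded_mfun C (fun w => f w + g w).
Proof.
move=> [mf [M fM]] [mg [N gN]]; split; first exact: measurable_funD.
by exists (M + N) => w; rewrite (le_trans (ler_normD _ _))// lerD.
Qed.

Lemma bounded_mfunN C f : bounded_mfun C f -> bounded_mfun C (fun w => - f w).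
Proof.
move=> [mf [M fM]]; split; first exact: (measurable_funN mf).
by exists M => w; rewrite normrN.
Qed.

Lemma bounded_mfunB C f g : bounded_mfun C f -> bounded_mfun C g ->
  bounded_mfun C (fun w => f w - g w).
Proof. by move=> bf bg; apply: bounded_mfunD => //; exact: bounded_mfunN. Qed.

Lemma bounded_mfunM C f g : bounded_mfun C f -> bounded_mfun C g ->
  bounded_mfun C (fun w => f w * g w).
Proof.
move=> [mf [M fM]] [mg [N gN]]; split; first exact: measurable_funM.
by exists (M * N) => w; rewrite normrM ler_pM.
Qed.

Lemma bounded_mfunX C f n : bounded_mfun C f ->
  bounded_mfun C (fun w => f w ^+ n).
Proof.
move=> bf; elim: n => [|n IH]; first exact: bounded_mfun_cst.
under eq_fun do rewrite exprS; exact: bounded_mfunM.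
Qed.

Lemma bounded_mfun_sum C (I : Type) (r : seq I) (Q : pred I)
    (F : I -> Omega -> R) : (forall i, Q i -> bounded_mfun C (F i)) ->
  bounded_mfun C (fun w => \sum_(i <- r | Q i) F i w).
Proof.
move=> bF; elim: r => [|i r IH].
  by under eq_fun do rewrite big_nil; exact: bounded_mfun_cst.
case: (boolP (Q i)) => Qi.
  under eq_fun do rewrite big_cons Qi.
  by apply: bounded_mfunD => //; exact: bF.
by under eq_fun do rewrite big_cons (negbTE Qi).
Qed.

Lemma sub_bounded_mfun C1 C2 f : <<s C1 >> `<=` <<s C2 >> ->
  bounded_mfun C1 f -> bounded_mfun C2 f.
Proof.
by move=> C12 [mf bf]; split => // mT B mB; apply: C12; exact: mf.
Qed.

Lemma bounded_mfun_measurable C f : <<s C >> `<=` measurable ->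
  bounded_mfun C f -> measurable_fun setT f.
Proof. by move=> Cm [mf _] mT B mB; apply: Cm; exact: mf. Qed.

Lemma bounded_mfun_integrable C f : <<s C >> `<=` measurable ->
  bounded_mfun C f -> P.-integrable setT (EFin \o f).
Proof.
move=> Cm bf; have mf := bounded_mfun_measurable _ _ Cm bf.
apply: measurable_bounded_integrable => //.
  by rewrite (le_lt_trans (probability_le1 _ _)) ?ltry.
case: bf => _ [M fM]; exists M; split; first exact: num_real.
by move=> N MN w _; exact: le_trans (ltW MN).
Qed.

(** Independence makes the law of [(f, g)] agree with the product of the marginal laws on
    rectangles, hence everywhere; Fubini for (x, y) |-> xy then factors the integral. *)
Lemma Rintegral_indepM C1 C2 f g :
  <<s C1 >> `<=` measurable -> <<s C2 >> `<=` measurable ->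
  (forall A B, <<s C1 >> A -> <<s C2 >> B -> P (A `&` B) = (P A * P B)%E) ->
  bounded_mfun C1 f -> bounded_mfun C2 g ->
  \int[P]_w (f w * g w) = (\int[P]_w f w) * (\int[P]_w g w).
Proof.
move=> sC1 sC2 C12 bf bg.
have mf := bounded_mfun_measurable _ _ sC1 bf.
have mg := bounded_mfun_measurable _ _ sC2 bg.
have intf := bounded_mfun_integrable _ _ sC1 bf.
have intg := bounded_mfun_integrable _ _ sC2 bg.
have intfg : P.-integrable setT (EFin \o (fun w => f w * g w)).
  (* [f] and [g] read different sigma-algebras, so their product is handled in the full one. *)
  apply: (bounded_mfun_integrable measurable).
    by rewrite sigma_algebra_id//; exact: sigma_algebra_measurable.
  have sm : <<s @measurable _ Omega >> = measurable.
    by rewrite sigma_algebra_id//; exact: sigma_algebra_measurable.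
  by apply: bounded_mfunM; [apply: sub_bounded_mfun bf|apply: sub_bounded_mfun bg];
    rewrite sm.
have mh : measurable_fun setT (fun w => (f w, g w)).
  exact/measurable_fun_pairP.
pose F : {mfun Omega >-> R} := HB.pack f (isMeasurableFun.Build _ _ _ _ f mf).
pose G : {mfun Omega >-> R} := HB.pack g (isMeasurableFun.Build _ _ _ _ g mg).
pose H : {mfun Omega >-> (R * R)%type} :=
  HB.pack (fun w => (f w, g w)) (isMeasurableFun.Build _ _ _ _ _ mh).
pose m1 := distribution P F; pose m2 := distribution P G.
pose nu := distribution P H.
have m12 X : measurable X -> (m1 \x m2)%E X = nu X.
  apply: product_measure_unique => A B mA mB.
  rewrite -C12.
  - by congr (P _); apply/seteqP; split => w /=.
  - by rewrite -[X in <<s _ >> X]setTI; case: bf => mf' _; exact: mf'.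
  - by rewrite -[X in <<s _ >> X]setTI; case: bg => mg' _; exact: mg'.
pose k (z : R * R) : \bar R := (z.1 * z.2)%:E.
have mk : measurable_fun setT k.
  by apply/measurable_EFinP; apply: measurable_funM.
have intk : nu.-integrable setT k.
  by apply: integrable_pushforward => //; rewrite preimage_setT.
have intk' : (m1 \x m2)%E.-integrable setT k.
  apply/integrableP; split => //.
  rewrite (eq_measure_integral nu); first by case/integrableP : intk.
  by move=> A mA _; exact: m12.
have int2 : m2.-integrable setT (fun y : R => y%:E).
  by apply: integrable_pushforward => //; exact/measurable_EFinP.
have int1 : m1.-integrable setT (fun y : R => y%:E).
  by apply: integrable_pushforward => //; exact/measurable_EFinP.
have E1 : (\int[m1]_x x%:E = \int[P]_w (f w)%:E)%E.
  by rewrite integral_pushforward//; exact/measurable_EFinP.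
have E2 : (\int[m2]_x x%:E = \int[P]_w (g w)%:E)%E.
  by rewrite integral_pushforward//; exact/measurable_EFinP.
have EfgE : (\int[P]_w (f w * g w)%:E =
    (\int[P]_w (f w)%:E) * (\int[P]_w (g w)%:E))%E.
  transitivity (\int[nu]_z k z)%E.
    by rewrite integral_pushforward.
  transitivity (\int[(m1 \x m2)%E]_z k z)%E.
    by apply: eq_measure_integral => A mA _; rewrite [RHS]m12.
  rewrite -integral12_prod_meas1// /fubini_F /k /=.
  under eq_integral => x _ do
    [under eq_integral => y _ do rewrite EFinM; rewrite integralZl// E2].
  rewrite -(fineK (integrable_fin_num _ intg))//.
  by rewrite integralZr// E1.
rewrite /Rintegral EfgE fineM//; exact: integrable_fin_num.
Qed.

End BoundedMeasurable.

(** * Euclidean geometry, clipping and the scalar recursion *)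

Section Euclidean.
Context {R : realType} {d : nat}.
Implicit Types (u v w : 'rV[R]_d) (a : R).

Lemma dotvC u v : dotv u v = dotv v u.
Proof. by apply: eq_bigr => k _; rewrite mulrC. Qed.

Lemma dotvDl u v w : dotv (u + v) w = dotv u w + dotv v w.
Proof. by rewrite -big_split; apply: eq_bigr => k _; rewrite mxE mulrDl. Qed.

Lemma dotvZl a u v : dotv (a *: u) v = a * dotv u v.
Proof. by rewrite mulr_sumr; apply: eq_bigr => k _; rewrite mxE mulrA. Qed.

Lemma dotvNl u v : dotv (- u) v = - dotv u v.
Proof. by rewrite -scaleN1r dotvZl mulN1r. Qed.

Lemma dotvDr u v w : dotv w (u + v) = dotv w u + dotv w v.
Proof. by rewrite !(dotvC w) dotvDl. Qed.

Lemma dotvZr a u v : dotv v (a *: u) = a * dotv v u.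
Proof. by rewrite !(dotvC v) dotvZl. Qed.

Lemma dotvNr u v : dotv v (- u) = - dotv v u.
Proof. by rewrite !(dotvC v) dotvNl. Qed.

Definition dotvE := (dotvDl, dotvDr, dotvNl, dotvNr, dotvZl, dotvZr).

Lemma dotv_ge0 v : 0 <= dotv v v.
Proof. by apply: sumr_ge0 => k _; rewrite -expr2 sqr_ge0. Qed.

Lemma norm2_ge0 v : 0 <= norm2 v.
Proof. exact: sqrtr_ge0. Qed.

Lemma sqr_norm2 v : norm2 v ^+ 2 = dotv v v.
Proof. by rewrite sqr_sqrtr// dotv_ge0. Qed.

Lemma norm2_le v a : 0 <= a -> (norm2 v <= a) = (dotv v v <= a ^+ 2).
Proof. by move=> a0; rewrite -sqr_norm2 ler_sqr ?nnegrE ?norm2_ge0. Qed.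

(** Cauchy-Schwarz. For nonzero [u], the squared norm of |u|^2 v - <u,v> u equals |u|^2 (|u|^2 |v|^2
    - <u,v>^2), and the positive factor cancels. *)
Lemma normr_dotv u v : `|dotv u v| <= norm2 u * norm2 v.
Proof.
rewrite -(@ler_sqr _ `|dotv u v|) ?nnegrE ?mulr_ge0 ?norm2_ge0//.
rewrite real_normK ?num_real// exprMn !sqr_norm2.
have [u0|u0] := eqVneq (dotv u u) 0.
  suff -> : dotv u v = 0 by rewrite expr0n u0 mul0r.
  rewrite /dotv big1// => k _; move/eqP : u0.
  rewrite psumr_eq0 => [/allP/(_ k)|i _]; last by rewrite -expr2 sqr_ge0.
  by rewrite mem_index_enum mulf_eq0 orbb => /(_ isT)/eqP ->; rewrite mul0r.
have u_gt0 : 0 < dotv u u by rewrite lt_neqAle eq_sym u0 dotv_ge0.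
have := dotv_ge0 (dotv u u *: v - dotv u v *: u).
rewrite !dotvE (dotvC v u).
rewrite (_ : _ + _ = dotv u u * (dotv u u * dotv v v - dotv u v ^+ 2)); last by ring.
by rewrite pmulr_rge0// subr_ge0.
Qed.

Lemma dotv_le u v : dotv u v <= norm2 u * norm2 v.
Proof. exact: le_trans (ler_norm _) (normr_dotv _ _). Qed.

Lemma norm2D u v : norm2 (u + v) <= norm2 u + norm2 v.
Proof.
rewrite norm2_le ?addr_ge0 ?norm2_ge0// !dotvE (dotvC v u) -!sqr_norm2.
by have := dotv_le u v; nra.
Qed.

Lemma norm2N v : norm2 (- v) = norm2 v.
Proof. by rewrite /norm2 dotvNl dotvNr opprK. Qed.

Lemma norm2B u v : norm2 (u - v) <= norm2 u + norm2 v.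
Proof. by rewrite (le_trans (norm2D _ _))// norm2N. Qed.

Lemma norm2Z a v : norm2 (a *: v) = `|a| * norm2 v.
Proof.
by rewrite /norm2 dotvZl dotvZr mulrA -expr2 sqrtrM ?sqr_ge0// sqrtr_sqr.
Qed.

Lemma norm2_0 : norm2 (0 : 'rV[R]_d) = 0.
Proof. by rewrite -(scale0r 0) norm2Z normr0 mul0r. Qed.

Lemma norm2_coord v k : `|v 0 k| <= norm2 v.
Proof.
rewrite -(@ler_sqr _ `|_|) ?nnegrE ?norm2_ge0// real_normK ?num_real//.
rewrite sqr_norm2 /dotv (bigD1 k)//= -expr2 lerDl.
by apply: sumr_ge0 => i _; rewrite -expr2 sqr_ge0.
Qed.

Lemma norm2_projW D w : 0 <= D -> norm2 (projW D w) <= D.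
Proof.
rewrite /projW => D0; case: ifPn => //; rewrite -ltNge => Dw.
have w0 : 0 < norm2 w by exact: le_lt_trans Dw.
by rewrite norm2Z ger0_norm ?divfK ?gt_eqF// divr_ge0// ltW.
Qed.

(** Outside the ball the projection is s w with s = D/|w| <= 1. The two sides differ by (1 - s)((1 +
    s)|w|^2 - 2<w,u>), which is nonnegative because <w,u> <= D|w| = s|w|^2. *)
Lemma projW_contract D w u : 0 <= D -> norm2 u <= D ->
  norm2 (projW D w - u) ^+ 2 <= norm2 (w - u) ^+ 2.
Proof.
rewrite /projW => D0 uD; case: ifPn => //; rewrite -ltNge => Dw.
have w0 : 0 < norm2 w by exact: le_lt_trans Dw.
set s := D / norm2 w; have sw : s * norm2 w = D by rewrite divfK ?gt_eqF.
have s0 : 0 <= s by rewrite divr_ge0// ltW.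
have s1 : s <= 1 by rewrite ler_pdivrMr// mul1r ltW.
rewrite !sqr_norm2 !dotvE (dotvC u w) -!sqr_norm2.
have wu : dotv w u <= norm2 w * D.
  by rewrite (le_trans (dotv_le _ _))// ler_wpM2l// norm2_ge0.
rewrite -subr_ge0.
have : 0 <= (1 - s) * ((1 + s) * norm2 w ^+ 2 - 2 * dotv w u).
  rewrite mulr_ge0 ?subr_ge0//.
  have : 2 * dotv w u <= (1 + s) * norm2 w ^+ 2; last by rewrite -subr_ge0.
  rewrite (_ : _ * _ ^+ 2 = norm2 w * (norm2 w + s * norm2 w)); last by ring.
  by rewrite sw; nra.
by move=> H; lra.
Qed.

(** Jensen for the squared norm with denominators cleared; it serves both the phase 1 mean and the
    suffix average. *)
Lemma norm2_sum_sqr (n m : nat) (v : nat -> 'rV[R]_d) :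
  norm2 (\sum_(m <= k < m + n) v k) ^+ 2 <=
  n%:R * \sum_(m <= k < m + n) norm2 (v k) ^+ 2.
Proof.
elim: n => [|n IH].
  by rewrite addn0 !big_geq// norm2_0 expr0n mul0r.
rewrite addnS !big_nat_recr ?leq_addr//=.
set S := \sum_(_ <= _ < _) _; set N := \sum_(_ <= _ < _) _.
have N0 : 0 <= N by apply: sumr_ge0 => k _; exact: sqr_ge0.
have {}IH : norm2 S ^+ 2 <= n%:R * N by exact: IH.
rewrite sqr_norm2 !dotvE (dotvC _ S) -!sqr_norm2 -natr1.
have SV := dotv_le S (v (m + n)%N).
set V := norm2 (v (m + n)%N) in SV *; set M := norm2 S in SV IH *.
have V0 : 0 <= V by exact: norm2_ge0.
have M0 : 0 <= M by exact: norm2_ge0.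
have n0 : 0 <= n%:R :> R by [].
(* AM-GM, using [M^2 <= n N]. *)
suff : 2 * (M * V) <= N + n%:R * V ^+ 2.
  move=> H.
  rewrite (_ : (n%:R + 1) * _ =
    n%:R * N + V ^+ 2 + (N + n%:R * V ^+ 2)); last by ring.
  by lra.
rewrite -ler_sqr ?nnegrE ?mulr_ge0 ?addr_ge0 ?mulr_ge0 ?sqr_ge0//.
apply: (@le_trans _ _ (4 * (N * (n%:R * V ^+ 2)))).
  rewrite (_ : (2 * (M * V)) ^+ 2 = 4 * (M ^+ 2 * V ^+ 2)); last by ring.
  rewrite ler_pM2l// (_ : N * _ = n%:R * N * V ^+ 2); last by ring.
  by rewrite ler_wpM2r// sqr_ge0.
by have := sqr_ge0 (N - n%:R * V ^+ 2); nra.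
Qed.

End Euclidean.

(** * Clipping: monotonicity and the linear regime *)

Section Huber.
Context {R : realType}.
Implicit Types (r s e u : R).

Lemma normr_phiR r s : 0 <= r -> `|phiR r s| <= r.
Proof.
move=> r0; rewrite ler_norml /phiR le_min ge_min lexx/= le_max lexx orbT andbT.
lra.
Qed.

Lemma phiR_id r s : `|s| <= r -> phiR r s = s.
Proof.
by rewrite ler_norml => /andP[? ?]; rewrite /phiR max_l// min_r.
Qed.

Lemma phiR_mono r s e : s <= e -> phiR r s <= phiR r e.
Proof. by move=> se; rewrite /phiR le_min2// le_max2. Qed.

(** A nondecreasing function moves in the direction of [u]. This holds for every [e], so it covers
    arbitrarily corrupted samples. *)
Lemma phiR_gap r e u :
  phiR r (- e) * u <= phiR r (u - e) * u.
Proof.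
have [u0|u0] := leP 0 u; first by rewrite ler_wpM2r// phiR_mono// lerBrDl; lra.
by apply: ler_wnM2r; [exact: ltW|apply: phiR_mono; lra].
Qed.

(** Clipping is inactive at both points; the extra [u ^+ 2] of clean samples is the source of strong
    convexity. *)
Lemma phiR_gap_linear r e u : `|e| <= r -> `|u - e| <= r ->
  phiR r (u - e) * u = phiR r (- e) * u + u ^+ 2.
Proof. by move=> er ur; rewrite !phiR_id ?normrN//; ring. Qed.

End Huber.

(** * Harmonic sums and the scalar recursion *)

Section Rates.
Context {R : realType}.

Lemma harmonic_le_ln (n : nat) : (0 < n)%N ->
  \sum_(1 <= j < n.+1) (j%:R)^-1 <= 1 + ln (n%:R : R).
Proof.
elim: n => // -[|n] IH _; first by rewrite big_nat1 ln1 invr1 addr0.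
rewrite big_nat_recr//=; have {}IH := IH isT.
have n1 : 0 < n.+1%:R :> R by [].
have n2 : 0 < n.+2%:R :> R by [].
suff : (n.+2%:R)^-1 <= ln n.+2%:R - ln (n.+1%:R : R).
  by move=> H; apply: (le_trans (lerD IH H)); lra.
rewrite -ln_div ?posrE//.
(* ln(1 + x) <= x at x = -1/(n+2), where 1 + x = (n+1)/(n+2), bounds the new term by an increment of
   the logarithm. *)
have := @le_ln1Dx R (- n.+2%:R^-1).
have -> : 1 - n.+2%:R^-1 = (n.+2%:R / n.+1%:R)^-1 :> R.
  rewrite invf_div; apply: (mulIf (lt0r_neq0 n2)).
  by rewrite mulrBl mulVf ?gt_eqF// divfK ?gt_eqF// mul1r -natr1 addrK.
rewrite lnV ?posrE ?divr_gt0// lerN2; apply.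
by rewrite ltrN2 invf_lt1// ltr1n.
Qed.

(** Multiplying the step by t = k + 1 turns 1 - 1/t into t - 1, so t a_{t+1} telescopes with
    increments c/T + 4c/t. *)
Lemma descent_rate (c : R) (T : nat) (a : nat -> R) :
  0 <= c -> (0 < T)%N ->
  (forall k, (k < T)%N -> a k.+1 <= (1 - (k.+1%:R)^-1) * a k +
     c / (T%:R * k.+1%:R) + 4 * c / k.+1%:R ^+ 2) ->
  forall k, (k < T)%N ->
  k.+1%:R * a k.+1 <= c * k.+1%:R / T%:R + 4 * c * \sum_(1 <= j < k.+2) (j%:R)^-1.
Proof.
move=> c0 T0 step.
have T0' : 0 < T%:R :> R by rewrite ltr0n.
have key k : (k < T)%N -> k.+1%:R * a k.+1 <=
    k%:R * a k + c / T%:R + 4 * c / k.+1%:R.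
  move=> kT; have k0 : 0 < k.+1%:R :> R by [].
  apply: (le_trans (ler_wpM2l (ltW k0) (step k kT))).
  rewrite le_eqVlt; apply/orP; left; apply/eqP; rewrite -[k.+1%:R]natr1.
  by field; rewrite natr1 !gt_eqF.
elim => [|k IH] kT; apply: (le_trans (key _ kT)).
  (* At [k = 0] the contraction factor is 0: the initial distance is forgotten after one step. *)
  by rewrite mul0r big_nat1 invr1; lra.
have {}IH := IH (ltnW kT).
rewrite [X in _ <= _ + _ * X]big_nat_recr//=.
set H := \sum_(_ <= _ < _) _ in IH *.
have -> : c * k.+2%:R = c * k.+1%:R + c by rewrite -(natr1 k.+1) mulrDr mulr1.
rewrite [(_ + c) / _]mulrDl.
set q := c * k.+1%:R / T%:R in IH *; set p := c / T%:R.
set x := (k.+2%:R)^-1; set y := k.+1%:R * _ in IH *.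
by rewrite mulrDr; lra.
Qed.

End Rates.

(** * One pathwise step of projected SGD *)

Section Step.
Context {R : realType} {d : nat}.
Implicit Types (x mu m u w : 'rV[R]_d).

Lemma norm2_phase1_mean (T : nat) (z : nat -> 'rV[R]_d) : (0 < T)%N ->
  (forall i, (i < T)%N -> norm2 (z i) <= 1) -> norm2 (phase1_mean T z) <= 1.
Proof.
move=> T0 z1; have T0' : 0 < T%:R :> R by rewrite ltr0n.
rewrite /phase1_mean norm2Z ger0_norm ?invr_ge0// ler_pdivrMl// mulr1.
rewrite -ler_sqr ?nnegrE ?norm2_ge0//.
have := norm2_sum_sqr T 0 z; rewrite add0n !big_mkord => /le_trans; apply.
rewrite expr2 ler_wpM2l// -[leRHS](_ : \sum_(i < T) 1 = _); last first.
  by rewrite sumr_const card_ord.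
by apply: ler_sum => i _; rewrite expr_le1 ?norm2_ge0// z1.
Qed.

Lemma norm2_sub_step (eta g : R) u w :
  norm2 (u - eta *: (g *: w)) ^+ 2 = norm2 u ^+ 2 - 2 * eta * (g * dotv u w)
    + eta ^+ 2 * (g ^+ 2 * norm2 w ^+ 2).
Proof. by rewrite !sqr_norm2 !dotvE (dotvC w u); ring. Qed.

(* After taking expectations the terms linear in [p] vanish and [c p^2] yields
   the strong convexity [lam |w - u|^2]. *)
Lemma sgd_step (D sigma lam eta ep b : R) x mu m u w :
  0 <= D -> 0 <= sigma -> 0 < lam -> 0 <= eta ->
  norm2 x <= 1 -> norm2 mu <= 1 -> norm2 u <= D -> norm2 w <= D ->
  `|ep| <= sigma ->
  forall r p c f,
  r = 6 * D + sigma ->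
  p = dotv (w - u) (x - m) ->
  c = (b == 0)%:R ->
  f = phiR r (- (dotv u mu + ep + b)) ->
  norm2 (projW D (w - eta *: (phiR r (dotv w (x - mu) - (dotv u x + ep + b))
    *: (x - mu))) - u) ^+ 2 <=
  (1 + eta * lam) * norm2 (w - u) ^+ 2
  - 2 * eta * (f * p + c * p ^+ 2 + 2 * (c * dotv (w - u) (m - mu) * p))
  + eta * r ^+ 2 / lam * norm2 (m - mu) ^+ 2 + 4 * eta ^+ 2 * r ^+ 2.
Proof.
move=> D0 s0 lam0 eta0 x1 mu1 uD wD ep_s r p c f rE pE cE fE.
have r0 : 0 <= r by rewrite rE; lra.
apply: (le_trans (projW_contract _ _ _ D0 uD)).
set e := dotv u mu + ep + b; set q := dotv (w - u) (m - mu).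
rewrite -/q; set v := w - u in pE q *.
have vD : norm2 v <= 2 * D by have := norm2B w u; rewrite -/v; lra.
have xmu2 : norm2 (x - mu) <= 2 by have := norm2B x mu; lra.
(* [x - mu] splits as (x - m) + (m - mu): [p] is the centred part, [q] the bias of the estimated
   mean. *)
have uE : dotv v (x - mu) = p + q.
  by rewrite pE /q -dotvDr addrA subrK.
(* Labels are not centred, so the residual keeps the offset <u, mu>, which is absorbed into the
   noise [e]. *)
have -> : dotv w (x - mu) - (dotv u x + ep + b) = p + q - e.
  by rewrite -uE /v /e !dotvE; ring.
rewrite (_ : w - _ - u = v - eta *: (phiR r (p + q - e) *: (x - mu))); last first.
  by rewrite /v addrAC.
set g := phiR r (p + q - e).
rewrite norm2_sub_step uE.
have gap : f * (p + q) + c * (p + q) ^+ 2 <= g * (p + q).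
  rewrite cE; case: eqP => [b0|_]; last first.
    by rewrite mul0r addr0 fE; exact: phiR_gap.
  (* Here [r = 6 * D + sigma] matters: on a clean sample |e| <= D + sigma and |p + q| <= 2D * 2, so
     both arguments stay below 5D + sigma. *)
  rewrite mul1r fE /g -/e phiR_gap_linear//.
    have := normr_dotv u mu; have := ler_normD (dotv u mu) ep.
    rewrite /e b0 addr0.
    have : norm2 u * norm2 mu <= D * 1 by apply: ler_pM => //; exact: norm2_ge0.
    by rewrite rE; lra.
  have := normr_dotv u mu; have := ler_normD (dotv u mu) ep.
  have : norm2 u * norm2 mu <= D * 1 by apply: ler_pM => //; exact: norm2_ge0.
  have := normr_dotv v (x - mu); rewrite uE.
  have : norm2 v * norm2 (x - mu) <= (2 * D) * 2.
    by apply: ler_pM => //; exact: norm2_ge0.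
  have := ler_normB (p + q) e.
  by rewrite /e b0 addr0 rE; lra.
have fr : `|f| <= r by rewrite fE normr_phiR.
have gr : g ^+ 2 * norm2 (x - mu) ^+ 2 <= 4 * r ^+ 2.
  rewrite (_ : 4 * r ^+ 2 = r ^+ 2 * 2 ^+ 2); last by ring.
  apply: ler_pM; rewrite ?sqr_ge0//; last by rewrite ler_sqr ?nnegrE ?norm2_ge0.
  by rewrite -[g ^+ 2]real_normK ?num_real// ler_sqr ?nnegrE// normr_phiR.
(* AM-GM splits the bias term [f q]. *)
have fq : - (lam * norm2 v ^+ 2 + r ^+ 2 / lam * norm2 (m - mu) ^+ 2) <=
    2 * (f * q).
  have H : `|f * q| <= r * (norm2 v * norm2 (m - mu)).
    by rewrite normrM; apply: ler_pM => //; exact: normr_dotv.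
  (* Divided by [lam], this square gives |v|^2 the weight [lam], exactly half of what
     [2 * c * p ^+ 2] returns in expectation. *)
  have := sqr_ge0 (lam * norm2 v - r * norm2 (m - mu)).
  rewrite -(pmulr_rge0 _ (_ : 0 < lam^-1)) ?invr_gt0//.
  rewrite (_ : lam^-1 * _ = lam * norm2 v ^+ 2 + r ^+ 2 / lam * norm2 (m - mu) ^+ 2
     - 2 * (r * (norm2 v * norm2 (m - mu)))); last by field; rewrite gt_eqF.
  have := ler_norm (- (f * q)); rewrite normrN; lra.
(* Of the expansion of c (p + q)^2, the part c q^2 is dropped and the cross term is kept for its
   zero mean. *)
have cq : 0 <= c * q ^+ 2 by rewrite cE mulr_ge0 ?sqr_ge0.
set N := norm2 v ^+ 2 in fq *; set M := norm2 (m - mu) ^+ 2 in fq *.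
set K := r ^+ 2 / lam in fq *.
have -> : eta * r ^+ 2 / lam * M = eta * (K * M) by rewrite /K !mulrA.
have L1 := ler_wpM2l (sqr_ge0 eta) gr.
have L2 : eta * (2 * (f * p + c * p ^+ 2 + 2 * (c * q * p)) - lam * N - K * M)
    <= eta * (2 * (g * (p + q))).
  apply: ler_wpM2l => //; lra.
lra.
Qed.

End Step.

(** * Linearity and monotonicity of expectations of bounded functions *)

Section BoundedExpectation.
Context {dm : measure_display} {Omega : measurableType dm} {R : realType}
  (P : probability Omega R).
Variable C : set (set Omega).
Hypothesis sC : <<s C >> `<=` measurable.
Implicit Types f g : Omega -> R.

Lemma Rintegral_bD f g : bounded_mfun C f -> bounded_mfun C g ->
  \int[P]_w (f w + g w) = \int[P]_w f w + \int[P]_w g w.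
Proof. by move=> bf bg; rewrite RintegralD//; exact: (bounded_mfun_integrable _ _ _ sC). Qed.

Lemma Rintegral_bZ r f : bounded_mfun C f ->
  \int[P]_w (r * f w) = r * \int[P]_w f w.
Proof. by move=> bf; rewrite RintegralZl//; exact: (bounded_mfun_integrable _ _ _ sC). Qed.

Lemma Rintegral_prob_cst r : \int[P]_w r = r.
Proof.
by rewrite Rintegral_cst//= (@probability_setT _ _ _ P) mulr1.
Qed.

Lemma Rintegral_b_sum (I : Type) (s : seq I) (F : I -> Omega -> R) :
  (forall i, bounded_mfun C (F i)) ->
  \int[P]_w (\sum_(i <- s) F i w) = \sum_(i <- s) \int[P]_w F i w.
Proof.
move=> bF; elim: s => [|i s IH].
  by under eq_fun do rewrite big_nil; rewrite big_nil Rintegral_prob_cst.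
under eq_fun do rewrite big_cons.
by rewrite big_cons Rintegral_bD// ?IH//; apply: bounded_mfun_sum.
Qed.

Lemma le_Rintegral_b f g : bounded_mfun C f -> bounded_mfun C g ->
  (forall w, f w <= g w) -> \int[P]_w f w <= \int[P]_w g w.
Proof.
by move=> bf bg fg; apply: le_Rintegral => //; exact: (bounded_mfun_integrable _ _ _ sC).
Qed.

End BoundedExpectation.

Section BoundedVectors.
Context {dm : measure_display} {Omega : measurableType dm} {R : realType} {d : nat}.
Implicit Types (C : set (set Omega)) (u v : Omega -> 'rV[R]_d).

Definition bounded_mvec C u := forall k, bounded_mfun C (fun w => u w 0 k).

Lemma bounded_mfun_dotv C u v : bounded_mvec C u -> bounded_mvec C v ->
  bounded_mfun C (fun w => dotv (u w) (v w)).
Proof. by move=> bu bv; apply: bounded_mfun_sum => k _; exact: bounded_mfunM. Qed.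

Lemma bounded_mvec_cst C (a : 'rV[R]_d) : bounded_mvec C (fun=> a).
Proof. by move=> k; exact: bounded_mfun_cst. Qed.

Lemma bounded_mvecB C u v : bounded_mvec C u -> bounded_mvec C v ->
  bounded_mvec C (fun w => u w - v w).
Proof.
move=> bu bv k; under eq_fun do rewrite !mxE; exact: bounded_mfunB.
Qed.

Lemma bounded_mvecZ C (a : Omega -> R) v : bounded_mfun C a ->
  bounded_mvec C v -> bounded_mvec C (fun w => a w *: v w).
Proof.
move=> ba bv k; under eq_fun do rewrite !mxE; exact: bounded_mfunM.
Qed.

Lemma bounded_mvec_sum C (I : Type) (s : seq I) (Q : pred I)
    (F : I -> Omega -> 'rV[R]_d) : (forall i, Q i -> bounded_mvec C (F i)) ->
  bounded_mvec C (fun w => \sum_(i <- s | Q i) F i w).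
Proof.
move=> bF k; under eq_fun do rewrite summxE.
by apply: bounded_mfun_sum => i Qi; exact: bF.
Qed.

Lemma bounded_mfun_norm2_sqr C u : bounded_mvec C u ->
  bounded_mfun C (fun w => norm2 (u w) ^+ 2).
Proof.
by move=> bu; under eq_fun do rewrite sqr_norm2; exact: bounded_mfun_dotv.
Qed.

End BoundedVectors.

(** * Measurability of the iterates and of the output *)

Section MeasurableVectors.
Context {du : measure_display} {U : measurableType du} {R : realType} {d : nat}.
Implicit Types (u v : U -> 'rV[R]_d) (f : U -> R).

Definition measurable_vec u := forall k, measurable_fun setT (fun w => u w 0 k).

Lemma measurable_vec_cst (a : 'rV[R]_d) : measurable_vec (fun=> a).
Proof. by move=> k; exact: measurable_cst. Qed.

Lemma measurable_vecB u v : measurable_vec u -> measurable_vec v ->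
  measurable_vec (fun w => u w - v w).
Proof.
by move=> mu mv k; under eq_fun do rewrite !mxE; exact: measurable_funB.
Qed.

Lemma measurable_vecZ f v : measurable_fun setT f -> measurable_vec v ->
  measurable_vec (fun w => f w *: v w).
Proof.
by move=> mf mv k; under eq_fun do rewrite !mxE; exact: measurable_funM.
Qed.

Lemma measurable_dotv u v : measurable_vec u -> measurable_vec v ->
  measurable_fun setT (fun w => dotv (u w) (v w)).
Proof. by move=> mu mv; apply: measurable_sum => k; exact: measurable_funM. Qed.

Lemma measurable_norm2 u : measurable_vec u ->
  measurable_fun setT (fun w => norm2 (u w)).
Proof.
move=> mu; under eq_fun do rewrite /norm2 -powR12_sqrt ?dotv_ge0//.
exact: (measurableT_comp (measurable_powR 2^-1) (measurable_dotv _ _ mu mu)).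
Qed.

Lemma measurable_phiR r f : measurable_fun setT f ->
  measurable_fun setT (fun w => phiR r (f w)).
Proof.
move=> mf; apply: measurable_minr; first exact: measurable_cst.
by apply: measurable_maxr => //; exact: measurable_cst.
Qed.

Lemma measurable_vec_projW D u : measurable_vec u ->
  measurable_vec (fun w => projW D (u w)).
Proof.
move=> mu k; have mn := measurable_norm2 _ mu.
(* The reciprocal of the norm is written as a power with exponent -1, a measurable function of the
   norm. *)
have -> : (fun w => projW D (u w) 0 k) = (fun w => if norm2 (u w) <= D then
    u w 0 k else D * (norm2 (u w)) `^ (- 1) * u w 0 k).
  apply/funext => w; rewrite /projW powRN powRr1 ?norm2_ge0//.
  by case: ifPn => // _; rewrite mxE.
apply: measurable_fun_ifT => //.
  by apply: measurable_fun_ler => //; exact: measurable_cst.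
apply: measurable_funM => //; apply: measurable_funM; first exact: measurable_cst.
exact: (measurableT_comp (measurable_powR (- 1)) mn).
Qed.

Lemma measurable_phase1_mean T (z : nat -> U -> 'rV[R]_d) :
  (forall i, (i < T)%N -> measurable_vec (z i)) ->
  measurable_vec (fun w => phase1_mean T (fun i => z i w)).
Proof.
move=> mz; apply: measurable_vecZ; first exact: measurable_cst.
by move=> k; under eq_fun do rewrite summxE; apply: measurable_sum => i; exact: mz.
Qed.

(** The space [U] is arbitrary so that it can be [Omega] with its own sigma-algebra or with that of
    the past; the second choice yields adaptedness. *)
Lemma measurable_wseq D r lam (mu : U -> 'rV[R]_d) (x : nat -> U -> 'rV[R]_d)
    (y : nat -> U -> R) n : measurable_vec mu ->
  (forall k, (k < n)%N -> measurable_vec (x k)) ->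
  (forall k, (k < n)%N -> measurable_fun setT (y k)) ->
  measurable_vec (fun w => wseq D r lam (mu w) (x ^~ w) (y ^~ w) n).
Proof.
move=> mmu; elim: n => [_ _|n IH mx my]; first exact: measurable_vec_cst.
have {}IH := IH (fun k kn => mx k (ltnW kn)) (fun k kn => my k (ltnW kn)).
have mxmu : measurable_vec (fun w => x n w - mu w).
  by apply: measurable_vecB => //; exact: mx.
apply: measurable_vec_projW; apply: measurable_vecB => //.
apply: measurable_vecZ; first exact: measurable_cst.
apply: measurable_vecZ => //; apply: measurable_phiR; apply: measurable_funB.
  exact: measurable_dotv.
exact: my.
Qed.

Lemma measurable_wbar D r lam T (z x : nat -> U -> 'rV[R]_d)
    (y : nat -> U -> R) : (forall i, (i < T)%N -> measurable_vec (z i)) ->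
  (forall k, (k < T)%N -> measurable_vec (x k)) ->
  (forall k, (k < T)%N -> measurable_fun setT (y k)) ->
  measurable_vec (fun w => wbar D r lam T (z ^~ w) (x ^~ w) (y ^~ w)).
Proof.
move=> mz mx my; apply: measurable_vecZ; first exact: measurable_cst.
move=> k; under eq_fun do rewrite summxE big_nat_cond big_mkcond.
apply: measurable_sum => i.
have [/andP[_ iT]|_] := boolP (T./2 <= i < T)%N; last exact: measurable_cst.
apply: measurable_wseq.
- exact: measurable_phase1_mean.
- by move=> j ji; apply: mx; exact: ltn_trans iT.
- by move=> j ji; apply: my; exact: ltn_trans iT.
Qed.

End MeasurableVectors.

(** * The algorithm with everywhere bounded data *)

Section BoundedSGD.
Context {dm : measure_display} {Omega : measurableType dm} {R : realType}
  (P : probability Omega R) (d : nat).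
Variables (D sigma alpha rho : R) (T : nat) (ws : 'rV[R]_d).
Variables (X : nat -> Omega -> 'rV[R]_d) (E B : nat -> Omega -> R).
Variable G : nat * 'I_3 -> set (set Omega).
Variables (m : 'rV[R]_d) (Sig : 'I_d -> 'I_d -> R).

(** Indices are (sample, component) with components [x], [eps], [b]. Samples below [T] form phase 1,
    and sample [T + k] drives the update from [W k] to [W k.+1]. *)
Let J0 (ic : nat * 'I_3) := (ic.1 < 2 * T)%N.
Let cx : 'I_3 := @Ordinal 3 0 isT.
Let ce : 'I_3 := @Ordinal 3 1 isT.
Let cb : 'I_3 := @Ordinal 3 2 isT.

Implicit Types (S U : pred (nat * 'I_3)) (i : nat).

Hypothesis Gsigma : forall j, J0 j -> sigma_algebra setT (G j).
Hypothesis Gmeas : forall j, J0 j -> G j `<=` measurable.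
Hypothesis Gindep : mutually_independent P J0 G.
Hypotheses (D0 : 0 <= D) (sigma0 : 0 <= sigma) (alpha1 : alpha < 1)
  (rho0 : 0 < rho) (T0 : (0 < T)%N) (wsD : norm2 ws <= D).
Hypothesis bX : forall i, (i < 2 * T)%N -> bounded_mvec (G (i, cx)) (X i).
Hypothesis X1 : forall i w, (i < 2 * T)%N -> norm2 (X i w) <= 1.
Hypothesis mE : forall i, (i < 2 * T)%N ->
  @measurable_fun _ _ (g_sigma_algebraType (G (i, ce))) R setT (E i).
Hypothesis Esigma : forall i w, (i < 2 * T)%N -> `|E i w| <= sigma.
Hypothesis mB : forall i, (i < 2 * T)%N ->
  @measurable_fun _ _ (g_sigma_algebraType (G (i, cb))) R setT (B i).
Hypothesis PB : forall i, (i < 2 * T)%N -> P [set w | B i w != 0] = alpha%:E.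
Hypothesis Xmean : forall i k, (i < 2 * T)%N -> \int[P]_w X i w 0 k = m 0 k.
Hypothesis Xcov : forall i k l, (i < 2 * T)%N ->
  \int[P]_w ((X i w - m) 0 k * (X i w - m) 0 l) = Sig k l.
Hypothesis Sig_rho : forall v : 'rV[R]_d,
  rho * dotv v v <= \sum_(k < d) \sum_(l < d) v 0 k * Sig k l * v 0 l.

Let sub_past (S U : pred (nat * 'I_3)) : (forall j, S j -> U j) ->
  <<s family_union G S >> `<=` <<s family_union G U >>.
Proof.
move=> SU; apply: smallest_sub; first exact: smallest_sigma_algebra.
by move=> A [j /SU Sj GA]; apply: sub_sigma_algebra; exists j.
Qed.

Let sub_fam (S : pred (nat * 'I_3)) j : S j ->
  <<s G j >> `<=` <<s family_union G S >>.
Proof.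
move=> Sj; apply: smallest_sub; first exact: smallest_sigma_algebra.
by move=> A GA; apply: sub_sigma_algebra; exists j.
Qed.

Let bfun S (f : Omega -> R) := bounded_mfun (family_union G S) f.
Let bvec S (f : Omega -> 'rV[R]_d) := bounded_mvec (family_union G S) f.
Let past n (ic : nat * 'I_3) := (ic.1 < n)%N.

Let bfun_sub S U f : (forall j, S j -> U j) -> bfun S f -> bfun U f.
Proof. by move=> SU; apply: sub_bounded_mfun; exact: sub_past. Qed.

Let bvec_sub S U f : (forall j, S j -> U j) -> bvec S f -> bvec U f.
Proof. by move=> SU bf k; apply: (bfun_sub _ _ _ SU); exact: bf. Qed.

Let bvecX S i : (i < 2 * T)%N -> S (i, cx) -> bvec S (X i).
Proof.
by move=> iT Si k; apply: (sub_bounded_mfun (G (i, cx)));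
  [exact: sub_fam|exact: bX].
Qed.

Let indep S1 S2 f g :
  (forall j, S1 j -> J0 j) -> (forall j, S2 j -> J0 j) ->
  (forall j, S1 j -> ~~ S2 j) -> bfun S1 f -> bfun S2 g ->
  \int[P]_w (f w * g w) = (\int[P]_w f w) * (\int[P]_w g w).
Proof.
move=> S1J S2J S12; apply: Rintegral_indepM.
- exact: (family_union_meas J0).
- exact: (family_union_meas J0).
- by move=> A A'; exact: (indep_family_union P J0).
Qed.

Let sJ : <<s family_union G J0 >> `<=` measurable.
Proof. exact: (family_union_meas J0). Qed.

Let only j : pred (nat * 'I_3) := fun k => k == j.

Let bvecXm S i : (i < 2 * T)%N -> S (i, cx) -> bvec S (fun w => X i w - m).
Proof.
move=> iT Si; apply: bounded_mvecB; [exact: bvecX|exact: bounded_mvec_cst].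
Qed.

Let centered i k : (i < 2 * T)%N -> \int[P]_w ((X i w - m) 0 k) = 0.
Proof.
move=> iT; under eq_fun do rewrite !mxE.
rewrite (Rintegral_bD _ _ sJ); last 2 first.
- by apply: bvecX.
- exact: bounded_mfun_cst.
by rewrite Rintegral_prob_cst Xmean// subrr.
Qed.

(** Coordinatewise, [z * v] is independent of the centred covariate. [S] may contain the noise of
    sample [i] itself; only its covariate is excluded. *)
Let dot_centered S i (v : Omega -> 'rV[R]_d) (z : Omega -> R) :
  (i < 2 * T)%N -> (forall j, S j -> J0 j) -> ~~ S (i, cx) ->
  bvec S v -> bfun S z -> \int[P]_w (z w * dotv (v w) (X i w - m)) = 0.
Proof.
move=> iT SJ Si bv bz.
under eq_fun do rewrite mulr_sumr.
have bS k : bfun S (fun w => z w * v w 0 k) by exact: bounded_mfunM.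
have bk k : bfun (only (i, cx)) (fun w => (X i w - m) 0 k).
  by apply: bvecXm => //; exact: eqxx.
under eq_fun do under eq_bigr do rewrite mulrA.
rewrite (Rintegral_b_sum _ _ sJ) => [|k]; last first.
  apply: bounded_mfunM; first exact: (bfun_sub _ _ _ SJ).
  by apply: bvecXm.
rewrite big1// => k _.
rewrite (indep S (only (i, cx)))//; first by rewrite centered// mulr0.
- by move=> j /eqP ->.
- by move=> j Sj; apply: contraNN Si => /eqP <-.
Qed.

(** The square expands into a double sum over coordinates, and independence replaces each product of
    centred coordinates by its mean. *)
Let dot_cov S i (v : Omega -> 'rV[R]_d) (z : Omega -> R) :
  (i < 2 * T)%N -> (forall j, S j -> J0 j) -> ~~ S (i, cx) ->
  bvec S v -> bfun S z ->
  \int[P]_w (z w * dotv (v w) (X i w - m) ^+ 2) =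
  \int[P]_w (z w * \sum_(k < d) \sum_(l < d) v w 0 k * Sig k l * v w 0 l).
Proof.
move=> iT SJ Si bv bz.
have bS k l : bfun S (fun w => z w * (v w 0 k * v w 0 l)).
  by apply: bounded_mfunM => //; exact: bounded_mfunM.
have bk k l : bfun (only (i, cx)) (fun w => (X i w - m) 0 k * (X i w - m) 0 l).
  by apply: bounded_mfunM; apply: bvecXm => //; exact: eqxx.
have bJ k l : bfun J0 (fun w => (X i w - m) 0 k * (X i w - m) 0 l).
  by apply: bounded_mfunM; apply: bvecXm.
have -> : (fun w => z w * dotv (v w) (X i w - m) ^+ 2) = (fun w =>
    \sum_(k < d) \sum_(l < d) (z w * (v w 0 k * v w 0 l)) *
      ((X i w - m) 0 k * (X i w - m) 0 l)).
  apply/funext => w; rewrite expr2 {1}/dotv mulr_suml mulr_sumr.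
  apply: eq_bigr => k _; rewrite /dotv !mulr_sumr; apply: eq_bigr => l _.
  by ring.
have -> : (fun w => z w * \sum_(k < d) \sum_(l < d) v w 0 k * Sig k l * v w 0 l)
    = (fun w => \sum_(k < d) \sum_(l < d) Sig k l * (z w * (v w 0 k * v w 0 l))).
  apply/funext => w; rewrite mulr_sumr; apply: eq_bigr => k _.
  by rewrite mulr_sumr; apply: eq_bigr => l _; ring.
have bSJ k l : bfun J0 (fun w => z w * (v w 0 k * v w 0 l)).
  exact: (bfun_sub _ _ _ SJ).
rewrite (Rintegral_b_sum _ _ sJ) => [|k]; last first.
  apply: bounded_mfun_sum => l _.
  exact: (bounded_mfunM _ _ _ (bSJ k l) (bJ k l)).
rewrite (Rintegral_b_sum _ _ sJ) => [|k]; last first.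
  apply: bounded_mfun_sum => l _; apply: bounded_mfunM (bSJ k l).
  exact: bounded_mfun_cst.
apply: eq_bigr => k _.
rewrite (Rintegral_b_sum _ _ sJ) => [|l]; last first.
  exact: (bounded_mfunM _ _ _ (bSJ k l) (bJ k l)).
rewrite (Rintegral_b_sum _ _ sJ) => [|l]; last first.
  by apply: bounded_mfunM (bSJ k l); exact: bounded_mfun_cst.
apply: eq_bigr => l _.
rewrite (Rintegral_bZ _ _ sJ _ _ (bSJ k l)).
rewrite (indep S (only (i, cx)))//; first by rewrite Xcov// mulrC.
- by move=> j /eqP ->.
- by move=> j Sj; apply: contraNN Si => /eqP <-.
Qed.

Let clean i w : R := (B i w == 0)%:R.

Let clean_bfun i : (i < 2 * T)%N -> bfun (only (i, cb)) (clean i).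
Proof.
move=> iT; split; last by exists 1 => w; rewrite /clean; case: eqP; rewrite ?normr1 ?normr0.
have -> : clean i = (fun w => if B i w == 0 then 1 else 0).
  by apply/funext => w; rewrite /clean; case: eqP.
apply: measurable_fun_ifT; [|exact: measurable_cst|exact: measurable_cst].
apply: measurable_fun_eqr; last exact: measurable_cst.
move=> mT A mA; apply: (sub_fam _ (i, cb)); first exact: eqxx.
exact: mB.
Qed.

Let clean_mean i : (i < 2 * T)%N -> \int[P]_w clean i w = 1 - alpha.
Proof.
move=> iT.
have mN : measurable [set w | B i w != 0].
  have bc : bfun J0 (clean i).
    by apply: bfun_sub (clean_bfun i iT) => j /eqP ->.
  have : measurable (clean i @^-1` [set 0]).
    rewrite -[X in measurable X]setTI.
    exact: (bounded_mfun_measurable _ _ sJ bc).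
  congr measurable; apply/seteqP; split => w /=; rewrite /clean.
    by case: eqP => // _ /eqP; rewrite oner_eq0.
  by case: eqP.
have -> : clean i = \1_(~` [set w | B i w != 0]).
  apply/funext => w; rewrite indicE /clean; congr (nat_of_bool _)%:R.
  apply/eqP/idP => [Bw|/set_mem/= /negP].
    by apply/mem_set; rewrite /= Bw eqxx.
  by rewrite negbK => /eqP.
rewrite /Rintegral integral_indic ?setIT//=; last exact: measurableC.
by rewrite (@probability_setC _ _ _ P)// PB.
Qed.

Let TJ k : (k < T)%N -> (T + k < 2 * T)%N.
Proof. by move=> kT; rewrite mul2n -addnn ltn_add2l. Qed.

Let mu w := phase1_mean T (fun i => X i w).
Let r := 6 * D + sigma.
Let lam := (1 - alpha) * rho.
Let Y i w := dotv ws (X i w) + E i w + B i w.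
Let W k w := wseq D r lam (mu w) (fun k => X (T + k)%N w)
  (fun k => Y (T + k)%N w) k.

Let r0 : 0 <= r. Proof. by rewrite addr_ge0// mulr_ge0. Qed.

Let lam0 : 0 < lam. Proof. by rewrite mulr_gt0// subr_gt0. Qed.

Let mu1 w : norm2 (mu w) <= 1.
Proof.
apply: norm2_phase1_mean => // i iT; apply: X1.
by rewrite (leq_trans iT)// leq_pmull.
Qed.

Let WD k w : norm2 (W k w) <= D.
Proof. by case: k => [|k]; [rewrite /W /= norm2_0|exact: norm2_projW]. Qed.

Let bmu S : (forall j, past T j -> S j) -> bvec S mu.
Proof.
move=> TS; apply: bounded_mvecZ; first exact: bounded_mfun_cst.
apply: bounded_mvec_sum => i _; apply: bvecX.
  by rewrite (leq_trans (ltn_ord i))// leq_pmull.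
exact/TS/ltn_ord.
Qed.

Let measE S i : (i < 2 * T)%N -> S (i, ce) ->
  @measurable_fun _ _ (g_sigma_algebraType (family_union G S)) R setT (E i).
Proof. by move=> iT Si mT A mA; apply: (sub_fam S (i, ce)) => //; exact: mE. Qed.

Let measB S i : (i < 2 * T)%N -> S (i, cb) ->
  @measurable_fun _ _ (g_sigma_algebraType (family_union G S)) R setT (B i).
Proof. by move=> iT Si mT A mA; apply: (sub_fam S (i, cb)) => //; exact: mB. Qed.

(** Adaptedness: [W k] reads phase 1 and the samples [T], ..., [T + k - 1], so sample [T + k] is
    fresh. *)
Let bW k : (k <= T)%N -> bvec (past (T + k)) (W k).
Proof.
move=> kT j; split; last first.
  by exists D => w; rewrite (le_trans (norm2_coord _ _)).
have iT l : (l < k)%N -> (T + l < 2 * T)%N.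
  by move=> lk; apply: TJ; exact: leq_trans kT.
have il l : (l < k)%N -> (T + l < T + k)%N by rewrite ltn_add2l.
have mx l : (l < k)%N ->
    measurable_vec (X (T + l)%N : g_sigma_algebraType (family_union G (past (T + k))) -> _).
  by move=> lk q; case: (bvecX (past (T + k)) (T + l)%N (iT _ lk) (il _ lk) q).
apply: (@measurable_wseq _ (g_sigma_algebraType (family_union G (past (T + k))))
  _ _ D r lam mu (fun k => X (T + k)%N) (fun k => Y (T + k)%N)).
- move=> q; have TS l : past T l -> past (T + k) l.
    by move=> lT; exact: leq_trans (leq_addr _ _).
  by case: (bmu _ TS q).
- exact: mx.
- move=> l lk; apply: measurable_funD; last exact: measB (iT _ lk) (il _ lk).
  apply: measurable_funD; last exact: measE (iT _ lk) (il _ lk).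
  by apply: measurable_dotv; [exact: measurable_vec_cst|exact: mx].
Qed.

Let bW_J k : (k <= T)%N -> bvec J0 (W k).
Proof.
move=> kT; apply: bvec_sub (bW _ kT) => j; rewrite /past /J0 => /leq_trans; apply.
by rewrite mul2n -addnn leq_add2l.
Qed.

Let bmu_J : bvec J0 mu.
Proof.
apply: bmu => j; rewrite /past /J0 => /leq_trans; apply.
by rewrite leq_pmull.
Qed.

Let a k := \int[P]_w (norm2 (W k w - ws) ^+ 2).

Let Xmm i k (z : Omega -> R) S : (i < 2 * T)%N -> (forall j, S j -> J0 j) ->
  ~~ S (i, cx) -> bfun S z -> \int[P]_w (z w * (X i w - m) 0 k) = 0.
Proof.
move=> iT SJ Si bz.
rewrite (indep S (only (i, cx)))//; first by rewrite centered// mulr0.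
- by move=> j /eqP ->.
- by move=> j Sj; apply: contraNN Si => /eqP <-.
- by apply: bvecXm => //; exact: eqxx.
Qed.

(** The trace is E|X - m|^2 = E|X|^2 - |m|^2, and |X| <= 1. *)
Let trace_Sig : \sum_(k < d) Sig k k <= 1.
Proof.
have T2 : (0 < 2 * T)%N by rewrite muln_gt0.
have bx : bvec J0 (X 0) by exact: bvecX.
have bc : bvec J0 (fun w => X 0%N w - m) by exact: bvecXm.
have -> : \sum_(k < d) Sig k k = \int[P]_w dotv (X 0%N w - m) (X 0%N w - m).
  rewrite (Rintegral_b_sum _ _ sJ) => [|k]; last exact: bounded_mfunM.
  by apply: eq_bigr => k _; rewrite Xcov.
have -> : \int[P]_w dotv (X 0%N w - m) (X 0%N w - m) =
    \int[P]_w (norm2 (X 0%N w) ^+ 2 - dotv m m).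
  (* The last summand has the shape of [dot_centered] with constant weight 1 and constant vector
     [m], which read no information ([pred0]). *)
  have -> : (fun w => dotv (X 0%N w - m) (X 0%N w - m)) = (fun w =>
      (norm2 (X 0%N w) ^+ 2 - dotv m m) + (- 2) * (1 * dotv m (X 0%N w - m))).
    by apply/funext => w; rewrite sqr_norm2 !dotvE (dotvC m); ring.
  have bN : bfun J0 (fun w => norm2 (X 0%N w) ^+ 2 - dotv m m).
    by apply: bounded_mfunB; [exact: bounded_mfun_norm2_sqr|exact: bounded_mfun_cst].
  have bM : bfun J0 (fun w => 1 * dotv m (X 0%N w - m)).
    apply: bounded_mfunM; first exact: bounded_mfun_cst.
    by apply: bounded_mfun_dotv => //; exact: bounded_mvec_cst.
  rewrite (Rintegral_bD _ _ sJ)//; last first.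
    by apply: bounded_mfunM => //; exact: bounded_mfun_cst.
  rewrite (Rintegral_bZ _ _ sJ _ _ bM) (dot_centered pred0 0 (fun=> m))//.
  - by rewrite mulr0 addr0.
  - exact: bounded_mvec_cst.
  - exact: bounded_mfun_cst.
rewrite -[leRHS](Rintegral_prob_cst P); apply: (le_Rintegral_b _ _ sJ).
- by apply: bounded_mfunB; [exact: bounded_mfun_norm2_sqr|exact: bounded_mfun_cst].
- exact: bounded_mfun_cst.
- move=> w; have := dotv_ge0 m.
  have : norm2 (X 0%N w) ^+ 2 <= 1 by rewrite expr_le1 ?norm2_ge0// X1.
  lra.
Qed.

(** Independence kills the off-diagonal products, so T of the T^2 survive, each contributing the
    trace of [Sig]. *)
Let mu_var : \int[P]_w (norm2 (m - mu w) ^+ 2) <= T%:R^-1.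
Proof.
have T_gt0 : 0 < T%:R :> R by rewrite ltr0n.
pose Z (i : 'I_T) k w := (X i w - m) 0 k.
have iT2 (i : 'I_T) : (i < 2 * T)%N.
  by rewrite (leq_trans (ltn_ord i))// leq_pmull.
have bZ (i : 'I_T) k : bfun J0 (Z i k) by apply: bvecXm => //; exact: iT2.
have -> : (fun w => norm2 (m - mu w) ^+ 2) = (fun w => T%:R ^- 2 *
    \sum_(k < d) \sum_(i < T) \sum_(j < T) Z i k w * Z j k w).
  apply/funext => w; rewrite sqr_norm2 /dotv mulr_sumr; apply: eq_bigr => k _.
  have -> : (m - mu w) 0 k = - (T%:R^-1 * \sum_(i < T) Z i k w).
    rewrite /Z /mu /phase1_mean !mxE summxE.
    under [in RHS]eq_bigr do rewrite !mxE.
    rewrite big_split/= sumr_const card_ord -[in RHS]mulr_natl.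
    by field; rewrite gt_eqF.
  rewrite mulrNN -exprVn mulrACA -expr2; congr (_ * _).
  by rewrite mulr_suml; apply: eq_bigr => i _; rewrite mulr_sumr.
have b1 (i : 'I_T) k : bfun J0 (fun w => \sum_(j < T) Z i k w * Z j k w).
  by apply: bounded_mfun_sum => j _; exact: (bounded_mfunM _ _ _ (bZ i k) (bZ j k)).
have b2 k : bfun J0 (fun w => \sum_(i < T) \sum_(j < T) Z i k w * Z j k w).
  by apply: bounded_mfun_sum => i _; exact: b1.
have b3 : bfun J0 (fun w => \sum_(k < d) \sum_(i < T) \sum_(j < T) Z i k w * Z j k w).
  by apply: bounded_mfun_sum => k _; exact: b2.
rewrite (Rintegral_bZ _ _ sJ _ _ b3) (Rintegral_b_sum _ _ sJ _ _ _ b2).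
have -> : \sum_(k < d) \int[P]_w (\sum_(i < T) \sum_(j < T) Z i k w * Z j k w) =
    T%:R * \sum_(k < d) Sig k k.
  rewrite mulr_sumr; apply: eq_bigr => k _.
  rewrite (Rintegral_b_sum _ _ sJ) => [|i]; last exact: b1.
  have E1 (i : 'I_T) : \int[P]_w (\sum_(j < T) Z i k w * Z j k w) = Sig k k.
    rewrite (Rintegral_b_sum _ _ sJ) => [|j]; last first.
      exact: (bounded_mfunM _ _ _ (bZ i k) (bZ j k)).
    rewrite (bigD1 i)//= big1 ?addr0; first by rewrite Xcov.
    move=> j ji; apply: (Xmm j k (Z i k) (only (val i, cx))) => //.
    - by move=> l /eqP ->; exact: iT2.
    - by rewrite /only xpair_eqE eqxx andbT; apply: contra_neq ji => /val_inj.
    - by apply: bvecXm; [exact: iT2|exact: eqxx].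
  under eq_bigr do rewrite E1.
  by rewrite sumr_const card_ord mulr_natl.
rewrite mulrA (_ : T%:R ^- 2 * _ = T%:R^-1); last by field; rewrite gt_eqF.
by rewrite ler_piMr ?trace_Sig// invr_ge0 ltW.
Qed.

Let descent k : (k < T)%N -> a k.+1 <= (1 - (k.+1%:R)^-1) * a k +
  r ^+ 2 / lam ^+ 2 / (T%:R * k.+1%:R) + 4 * (r ^+ 2 / lam ^+ 2) / k.+1%:R ^+ 2.
Proof.
move=> kT; have iT := TJ _ kT; set i := (T + k)%N in iT.
have T_gt0 : 0 < T%:R :> R by rewrite ltr0n.
have k_gt0 : 0 < k.+1%:R :> R by [].
pose eta := (lam * k.+1%:R)^-1.
have eta0 : 0 < eta by rewrite invr_gt0 mulr_gt0.
pose v w := W k w - ws.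
pose f w := phiR r (- (dotv ws (mu w) + E i w + B i w)).
pose p w := dotv (v w) (X i w - m).
pose z w := clean i w * dotv (v w) (m - mu w).
pose quad w := \sum_(k < d) \sum_(l < d) v w 0 k * Sig k l * v w 0 l.
(* Everything that [f], [z] and [v] read: the past and the noise of the current sample, but not its
   covariate. *)
pose S (j : nat * 'I_3) := past (T + k) j || (j == (i, ce)) || (j == (i, cb)).
have Spast j : past (T + k) j -> S j by rewrite /S => ->.
have SJ j : S j -> J0 j.
  move=> /orP[/orP[|/eqP ->]|/eqP ->]//; rewrite /past /J0 => /ltn_trans; apply.
  exact: iT.
have Sx : ~~ S (i, cx) by rewrite /S /past /= ltnn !xpair_eqE !andbF.
have Se : S (i, ce) by rewrite /S eqxx orbT.
have Sb : S (i, cb) by rewrite /S eqxx orbT.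
have bvp : bvec (past (T + k)) v.
  by apply: bounded_mvecB; [apply: bW; exact: ltnW|exact: bounded_mvec_cst].
have bv : bvec S v by exact: bvec_sub bvp.
have bmuS : bvec S mu.
  by apply: bmu => j jT; apply: Spast; rewrite /past (leq_trans jT)// leq_addr.
have bf : bfun S f.
  split; last by exists r => w; exact: normr_phiR.
  apply: measurable_phiR; apply: measurable_funN.
  apply: measurable_funD; last exact: measB.
  apply: measurable_funD; last exact: measE.
  by case: (bounded_mfun_dotv _ _ _ (bounded_mvec_cst _ ws) bmuS).
have bc : bfun S (clean i).
  by apply: bfun_sub (clean_bfun _ iT) => j /eqP ->.
have bz : bfun S z.
  apply: bounded_mfunM => //; apply: bounded_mfun_dotv => //.
  by apply: bounded_mvecB => //; exact: bounded_mvec_cst.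
have JS g : bfun S g -> bfun J0 g by exact: bfun_sub.
have bp : bfun J0 p.
  apply: bounded_mfun_dotv; last exact: bvecXm.
  by apply: bvec_sub bv.
have bfp : bfun J0 (fun w => f w * p w) by apply: bounded_mfunM => //; exact: JS.
have bcp : bfun J0 (fun w => clean i w * p w ^+ 2).
  by apply: bounded_mfunM; [exact: JS|exact: bounded_mfunX].
have bzp : bfun J0 (fun w => z w * p w) by apply: bounded_mfunM => //; exact: JS.
have bN : bfun J0 (fun w => norm2 (v w) ^+ 2).
  by apply: bounded_mfun_norm2_sqr; exact: bvec_sub bv.
have bM : bfun J0 (fun w => norm2 (m - mu w) ^+ 2).
  by apply: bounded_mfun_norm2_sqr; apply: bounded_mvecB => //;
    exact: bounded_mvec_cst.
have Ifp : \int[P]_w (f w * p w) = 0 by exact: (dot_centered S).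
have Izp : \int[P]_w (z w * p w) = 0 by exact: (dot_centered S).
(* After [p ^+ 2] is averaged to the quadratic form of [Sig], [clean i] reads only [b] of sample [i]
   and the form only the past; factoring gives (1 - alpha) rho = lam. *)
have Icp : lam * a k <= \int[P]_w (clean i w * p w ^+ 2).
  rewrite (dot_cov S)//.
  have bq : bfun (past (T + k)) quad.
    apply: bounded_mfun_sum => k1 _; apply: bounded_mfun_sum => k2 _.
    apply: bounded_mfunM => //; apply: bounded_mfunM => //.
    exact: bounded_mfun_cst.
  rewrite (indep (only (i, cb)) (past (T + k)) _ _ _ _ _ (clean_bfun _ iT) bq)//.
  - rewrite clean_mean// -mulrA ler_pM2l ?subr_gt0//.
    rewrite /a -(Rintegral_bZ _ _ sJ _ _ bN); apply: (le_Rintegral_b _ _ sJ).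
    + by apply: bounded_mfunM => //; exact: bounded_mfun_cst.
    + by apply: JS; apply: bfun_sub bq.
    + by move=> w; rewrite sqr_norm2; exact: Sig_rho.
  - by move=> j /eqP ->.
  - by move=> j jT; apply: SJ; exact: Spast.
  - by move=> j /eqP ->; rewrite /past/= ltnn.
have bound w : norm2 (W k.+1 w - ws) ^+ 2 <=
    (1 + eta * lam) * norm2 (v w) ^+ 2 + ((- (2 * eta)) * (f w * p w) +
    ((- (2 * eta)) * (clean i w * p w ^+ 2) + ((- (4 * eta)) * (z w * p w) +
    (eta * r ^+ 2 / lam * norm2 (m - mu w) ^+ 2 + 4 * eta ^+ 2 * r ^+ 2)))).
  have := sgd_step D sigma lam eta (E i w) (B i w) (X i w) (mu w) m ws (W k w)
    D0 sigma0 lam0 (ltW eta0) (X1 _ _ iT) (mu1 w) wsD (WD k w) (Esigma _ _ iT)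
    r (p w) (clean i w) (f w) erefl erefl erefl erefl.
  by rewrite -/(v w) -/(z w) => /le_trans; apply; lra.
have bcst (s : R) : bfun J0 (fun=> s) by exact: bounded_mfun_cst.
have bZ s g : bfun J0 g -> bfun J0 (fun w => s * g w).
  exact: (bounded_mfunM _ _ _ (bcst s)).
have bD g h : bfun J0 g -> bfun J0 h -> bfun J0 (fun w => g w + h w).
  exact: bounded_mfunD.
have cM := bZ (eta * r ^+ 2 / lam) _ bM.
have cz := bZ (- (4 * eta)) _ bzp.
have cc := bZ (- (2 * eta)) _ bcp.
have cf := bZ (- (2 * eta)) _ bfp.
have cN := bZ (1 + eta * lam) _ bN.
have b4 := bD _ _ cM (bcst (4 * eta ^+ 2 * r ^+ 2)).
have b3 := bD _ _ cz b4.
have b2 := bD _ _ cc b3.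
have b1 := bD _ _ cf b2.
have b0 := bD _ _ cN b1.
have : a k.+1 <= (1 + eta * lam) * a k - 2 * eta * (lam * a k) +
    (eta * r ^+ 2 / lam * T%:R^-1 + 4 * eta ^+ 2 * r ^+ 2).
  have L1 : 2 * eta * (lam * a k) <= 2 * eta * \int[P]_w (clean i w * p w ^+ 2).
    by rewrite ler_pM2l// mulr_gt0.
  have L2 : eta * r ^+ 2 / lam * \int[P]_w (norm2 (m - mu w) ^+ 2) <=
      eta * r ^+ 2 / lam * T%:R^-1.
    rewrite ler_wpM2l// divr_ge0 ?(ltW lam0)// mulr_ge0 ?sqr_ge0//.
    exact: ltW.
  have bW1 : bfun J0 (fun w => norm2 (W k.+1 w - ws) ^+ 2).
    apply: bounded_mfun_norm2_sqr; apply: bounded_mvecB; first exact: bW_J.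
    exact: bounded_mvec_cst.
  have := le_Rintegral_b P _ sJ _ _ bW1 b0 bound; rewrite -/(a k.+1).
  rewrite (Rintegral_bD _ _ sJ _ _ cN b1) (Rintegral_bD _ _ sJ _ _ cf b2).
  rewrite (Rintegral_bD _ _ sJ _ _ cc b3) (Rintegral_bD _ _ sJ _ _ cz b4).
  rewrite (Rintegral_bD _ _ sJ _ _ cM (bcst _)).
  rewrite (Rintegral_bZ _ _ sJ _ _ bN) (Rintegral_bZ _ _ sJ _ _ bfp).
  rewrite (Rintegral_bZ _ _ sJ _ _ bcp) (Rintegral_bZ _ _ sJ _ _ bzp).
  rewrite (Rintegral_bZ _ _ sJ _ _ bM) Rintegral_prob_cst Ifp Izp -/(a k).
  by move=> H; lra.
(* Since eta * lam = 1/(k+1), the coefficients 1 + eta lam and -2 eta lam combine to 1 - 1/(k+1) and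
   the two sides are equal. *)
move=> /le_trans; apply; rewrite le_eqVlt; apply/orP; left; apply/eqP.
by rewrite /eta; field; rewrite !gt_eqF.
Qed.

Lemma bounded_sgd_rate : ~~ odd T ->
  (\int[P]_w (norm2 (wbar D r lam T (fun i => X i w) (fun k => X (T + k)%N w)
    (fun k => Y (T + k)%N w) - ws) ^+ 2)%:E <=
  (72 * r ^+ 2 * (2 * ln T%:R + 1) / (lam ^+ 2 * T%:R))%:E)%E.
Proof.
move=> evenT; set n := T./2.
have nT : (n + n)%N = T by rewrite addnn -[RHS]odd_double_half (negbTE evenT).
have n_gt0 : (0 < n)%N by have := T0; rewrite -nT addn_gt0 orbb.
have T_gt0 : 0 < T%:R :> R by rewrite ltr0n.
have n0 : 0 < n%:R :> R by rewrite ltr0n.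
have TR : T%:R = n%:R + n%:R :> R by rewrite -natrD nT.
set c := r ^+ 2 / lam ^+ 2.
have c0 : 0 <= c by rewrite divr_ge0 ?sqr_ge0.
pose H : R := 1 + ln T%:R.
have lnT : 0 <= ln (T%:R : R) by rewrite ln_ge0// ler1n.
have H0 : 0 <= H by rewrite addr_ge0.
(* On the second half T <= 2k, hence 4cH/k <= 8cH/T; this is what averaging only the suffix buys. *)
have aQ k : (n <= k < n + n)%N -> a k <= c / T%:R * (1 + 8 * H).
  case: k => [|k] /andP[nk]; first by move: n_gt0; rewrite ltnNge nk.
  rewrite nT => /ltnW kT; have k0 : 0 < k.+1%:R :> R by [].
  have := descent_rate c T a c0 T0 descent k kT.
  have := harmonic_le_ln k.+1 isT (R := R).
  have : ln (k.+1%:R : R) <= ln T%:R by rewrite ler_ln ?posrE// ler_nat.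
  set h := \sum_(_ <= _ < _) _ => L1 L2 L3.
  have hH : h <= H by rewrite /H; lra.
  have kTR : T%:R <= 2 * k.+1%:R :> R.
    by rewrite TR; have : n%:R <= k.+1%:R :> R; [rewrite ler_nat|lra].
  rewrite -(ler_pM2l k0); apply: (le_trans L3).
  have M1 : 4 * c * h <= 4 * c * H by rewrite ler_wpM2l// mulr_ge0.
  have M2 : c * H * 4 * T%:R <= c * H * 4 * (2 * k.+1%:R).
    by apply: ler_wpM2l kTR; apply: mulr_ge0 => //; exact: mulr_ge0.
  rewrite -(ler_pM2r T_gt0).
  have -> : k.+1%:R * (c / T%:R * (1 + 8 * H)) * T%:R = k.+1%:R * c * (1 + 8 * H).
    by field; rewrite gt_eqF.
  rewrite mulrDl divfK ?gt_eqF//.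
  have : 4 * c * h * T%:R <= 4 * c * H * T%:R by rewrite ler_pM2r.
  lra.
have bNk k : (n <= k < n + n)%N -> bfun J0 (fun w => norm2 (W k w - ws) ^+ 2).
  move=> /andP[_]; rewrite nT => /ltnW kT.
  apply: bounded_mfun_norm2_sqr; apply: bounded_mvecB; first exact: bW_J.
  exact: bounded_mvec_cst.
(* Exchanging sum and integral asks for boundedness at every index, while [W k] is controlled only
   for [k <= T]; hence the extension by 0. *)
pose F k w := if (n <= k < n + n)%N then norm2 (W k w - ws) ^+ 2 else 0.
have bF k : bfun J0 (F k).
  have [kn|/negbTE kn] := boolP (n <= k < n + n)%N; rewrite /F kn.
    exact: bNk.
  exact: bounded_mfun_cst.
have bS : bfun J0 (fun w => \sum_(n <= k < n + n) F k w).
  by apply: bounded_mfun_sum => k _; exact: bF.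
pose V w := wbar D r lam T (fun i => X i w) (fun k => X (T + k)%N w)
  (fun k => Y (T + k)%N w) - ws.
have VE w : V w = (2 / T%:R) *: \sum_(n <= k < n + n) (W k w - ws).
  rewrite /V /wbar -/n nT big_split/= scalerDr; congr (_ + _).
  have Tn : (T - n = n)%N by rewrite -{1}nT addnK.
  rewrite sumr_const_nat Tn -[- ws *+ n]scaler_nat scalerA (_ : 2 / _ * _ = 1) ?scale1r//.
  by rewrite TR; field; rewrite gt_eqF// addr_gt0.
have pw w : norm2 (V w) ^+ 2 <= 2 / T%:R * \sum_(n <= k < n + n) F k w.
  rewrite VE norm2Z exprMn real_normK ?num_real//.
  have FE : \sum_(n <= k < n + n) F k w = \sum_(n <= k < n + n) norm2 (W k w - ws) ^+ 2.
    by rewrite big_nat [RHS]big_nat; apply: eq_bigr => k kn; rewrite /F kn.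
  rewrite FE; have := norm2_sum_sqr n n (fun k => W k w - ws) => L.
  have c2 : 0 <= (2 / T%:R) ^+ 2 :> R by exact: sqr_ge0.
  apply: (le_trans (ler_wpM2l c2 L)).
  rewrite mulrA (_ : (2 / T%:R) ^+ 2 * n%:R = 2 / T%:R)//.
  by rewrite TR; field; rewrite gt_eqF// addr_gt0.
have bV : bfun J0 (fun w => norm2 (V w) ^+ 2).
  apply: bounded_mfun_norm2_sqr => k; under eq_fun do rewrite VE.
  apply: bounded_mvecZ; first exact: bounded_mfun_cst.
  have -> : (fun w => \sum_(n <= k0 < n + n) (W k0 w - ws)) =
      (fun w => \sum_(n <= k0 < n + n | (n <= k0 < n + n)%N) (W k0 w - ws)).
    by apply/funext => w; rewrite big_nat.
  apply: bounded_mvec_sum => j /andP[_]; rewrite nT => /ltnW jT.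
  by apply: bounded_mvecB; [exact: bW_J|exact: bounded_mvec_cst].
rewrite -[leLHS]fineK; last first.
  by apply: integrable_fin_num => //; exact: (bounded_mfun_integrable P _ _ sJ bV).
rewrite lee_fin.
apply: (@le_trans _ _ (2 / T%:R * \sum_(n <= k < n + n) (c / T%:R * (1 + 8 * H)))).
  have := le_Rintegral_b P _ sJ _ _ bV _ pw.
  rewrite (Rintegral_bZ _ _ sJ _ _ bS) (Rintegral_b_sum _ _ sJ _ _ _ bF).
  move=> L; apply: le_trans (L _) _.
    by apply: bounded_mfunM bS; exact: bounded_mfun_cst.
  rewrite ler_wpM2l ?divr_ge0 ?(ltW T_gt0)//.
  rewrite big_nat [leRHS]big_nat; apply: ler_sum => k kn.
  by apply: le_trans (aQ _ kn); rewrite /F kn.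
rewrite sumr_const_nat addnK -[_ *+ n]mulr_natl.
rewrite (_ : 2 / _ * _ = c / T%:R * (1 + 8 * H)); last first.
  by rewrite TR; field; rewrite gt_eqF// addr_gt0.
rewrite (_ : 72 * _ * _ / _ = c / T%:R * (72 * (2 * ln T%:R + 1))); last first.
  by rewrite /c; field; rewrite !gt_eqF.
(* The proof gives the constant 9 + 8 ln T, well below 72 (2 ln T + 1). *)
by apply: ler_wpM2l; [exact: divr_ge0|rewrite /H; lra].
Qed.

End BoundedSGD.

(** * Equality in law and truncation *)

Section EqualLaw.
Import numFieldNormedType.Exports.
Context {dm : measure_display} {Omega : measurableType dm} {R : realType}
  {d : nat} (P : probability Omega R).
Implicit Types X Y : Omega -> 'rV[R]_d.

(** Generating the sigma-algebra of row vectors by boxes lets [same_law_vec] be read as equality of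
    two distributions on a pi-system. *)
Definition boxes : set (set 'rV[R]_d) :=
  [set V | exists2 A : 'I_d -> set R, (forall k, measurable (A k)) &
    V = [set v : 'rV[R]_d | forall k, A k (v 0 k)]].

Local Notation borel_rV := (g_sigma_algebraType boxes).

Lemma boxesI : setI_closed boxes.
Proof.
move=> _ _ [A mA ->] [B mB ->]; exists (fun k => A k `&` B k).
  by move=> k; exact: measurableI.
apply/seteqP; split => [v /= [Av Bv] k|v /= ABv]; first by split.
by split => k; case: (ABv k).
Qed.

Lemma boxesT : boxes setT.
Proof. by exists (fun=> setT) => //; apply/seteqP. Qed.

Lemma preimage_box X (A : 'I_d -> set R) :
  X @^-1` [set v : 'rV[R]_d | forall k, A k (v 0 k)] =
  \big[setI/setT]_(k < d) ((fun w => X w 0 k) @^-1` A k).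
Proof.
rewrite -bigcap_seq; apply/seteqP; split => [w Xw k _|w Xw k]; first exact: Xw.
by apply: (Xw k); rewrite /= mem_index_enum.
Qed.

Lemma measurable_borel_rV X : measurable_vec X ->
  measurable_fun setT (X : Omega -> borel_rV).
Proof.
move=> mX; apply: (@measurability _ _ Omega borel_rV setT X boxes) => // _ [_ [A mA ->] <-].
rewrite setTI preimage_box; apply: bigsetI_measurable => k _.
by rewrite -[X in measurable X]setTI; exact: mX.
Qed.

Lemma measurable_vec_id : measurable_vec (id : borel_rV -> 'rV[R]_d).
Proof.
move=> k mT A mA; rewrite setTI; apply: sub_sigma_algebra.
exists (fun l => if l == k then A else setT) => [l|]; first by case: ifPn.
apply/seteqP; split => [v /= Av l|v /= /(_ k)]; last by rewrite eqxx.
by case: eqP => [->|].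
Qed.

Lemma same_law_vec_preimage X Y (A : set borel_rV) :
  measurable_vec X -> measurable_vec Y -> same_law_vec P X Y -> measurable A ->
  P (X @^-1` A) = P (Y @^-1` A).
Proof.
move=> mX mY XY mA.
pose F : {mfun Omega >-> borel_rV} := HB.pack (X : Omega -> borel_rV)
  (isMeasurableFun.Build _ _ _ _ (X : Omega -> borel_rV) (measurable_borel_rV _ mX)).
pose G : {mfun Omega >-> borel_rV} := HB.pack (Y : Omega -> borel_rV)
  (isMeasurableFun.Build _ _ _ _ (Y : Omega -> borel_rV) (measurable_borel_rV _ mY)).
rewrite -[LHS]/(distribution P F A) -[RHS]/(distribution P G A).
apply: (@measure_unique _ R borel_rV boxes (fun=> setT) _ _ _ _
  (distribution P F) (distribution P G)) => //.
- exact: boxesI.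
- by move=> _; exact: boxesT.
- by rewrite bigcup_const.
- by move=> _ [B mB ->]; have := XY B mB; rewrite -!preimage_box.
- by move=> _; rewrite (le_lt_trans (probability_le1 _ _)) ?ltry.
Qed.

Lemma same_law_vec_Rintegral X Y (f : borel_rV -> R) (M : R) :
  measurable_vec X -> measurable_vec Y -> same_law_vec P X Y ->
  measurable_fun setT f -> (forall v, `|f v| <= M) ->
  \int[P]_w f (X w) = \int[P]_w f (Y w).
Proof.
move=> mX mY XY mf fM.
have sm : <<s @measurable _ Omega >> = measurable.
  by rewrite sigma_algebra_id//; exact: sigma_algebra_measurable.
have intf (Z : Omega -> 'rV[R]_d) : measurable_vec Z ->
    P.-integrable setT (EFin \o f \o Z).
  move=> mZ; apply: (bounded_mfun_integrable P measurable (f \o Z)).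
    by rewrite sm.
  split; last by exists M => w; exact: fM.
  have mfZ : measurable_fun setT (f \o (Z : Omega -> borel_rV)).
    exact: (measurableT_comp mf (measurable_borel_rV _ mZ)).
  by move=> mT A mA; rewrite /measurable/= sm; exact: mfZ.
have mEf : measurable_fun setT (EFin \o f) by exact/measurable_EFinP.
have push (Z : Omega -> 'rV[R]_d) (mZ : measurable_vec Z) :=
  integral_pushforward (measurable_borel_rV _ mZ) mEf (intf _ mZ) measurableT.
rewrite /Rintegral; congr fine.
rewrite -[LHS](push _ mX) -[RHS](push _ mY).
apply: eq_measure_integral; do ?exact: measurable_borel_rV.
by move=> ? ? A mA _; apply: same_law_vec_preimage.
Qed.

End EqualLaw.

Section UnitCutoff.
Context {R : realType} {d : nat}.

(* Truncating [x] here and [eps] by [phiR sigma] makes the data bounded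
   everywhere instead of almost everywhere, without changing the independence
   structure or, almost surely, the output of the algorithm. *)
Definition unit_cutoff (v : 'rV[R]_d) : 'rV[R]_d := if norm2 v <= 1 then v else 0.

Lemma norm2_unit_cutoff v : norm2 (unit_cutoff v) <= 1.
Proof. by rewrite /unit_cutoff; case: ifPn => // _; rewrite norm2_0. Qed.

Lemma measurable_unit_cutoff {du} {U : measurableType du} (u : U -> 'rV[R]_d) :
  measurable_vec u -> measurable_vec (fun w => unit_cutoff (u w)).
Proof.
move=> mu k; have -> : (fun w => unit_cutoff (u w) 0 k) =
    (fun w => if norm2 (u w) <= 1 then u w 0 k else 0).
  by apply/funext => w; rewrite /unit_cutoff; case: ifPn => // _; rewrite mxE.
apply: measurable_fun_ifT => //.
by apply: measurable_fun_ler; [exact: measurable_norm2|exact: measurable_cst].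
Qed.

Lemma eq_wseq D r lam (mu : 'rV[R]_d) (x x' : nat -> 'rV[R]_d) y y' n :
  (forall k, (k < n)%N -> x k = x' k) -> (forall k, (k < n)%N -> y k = y' k) ->
  wseq D r lam mu x y n = wseq D r lam mu x' y' n.
Proof.
elim: n => // n IH xE yE /=.
rewrite IH ?xE ?yE// => k kn; [apply: xE|apply: yE]; exact: ltnW.
Qed.

Lemma eq_wbar D r lam T (z z' x x' : nat -> 'rV[R]_d) y y' :
  (forall i, (i < T)%N -> z i = z' i) ->
  (forall k, (k < T)%N -> x k = x' k) -> (forall k, (k < T)%N -> y k = y' k) ->
  wbar D r lam T z x y = wbar D r lam T z' x' y'.
Proof.
move=> zE xE yE; rewrite /wbar; congr (_ *: _).
have -> : phase1_mean T z = phase1_mean T z'.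
  by rewrite /phase1_mean; congr (_ *: _); apply: eq_bigr => i _; exact: zE.
rewrite big_nat [RHS]big_nat; apply: eq_bigr => k /andP[_ kT].
by apply: eq_wseq => j jk; [apply: xE|apply: yE]; exact: ltn_trans kT.
Qed.

End UnitCutoff.

Section GenSigma.
Context {dm : measure_display} {Omega : measurableType dm} {R : realType}.
Implicit Types fs : set (Omega -> R).

Lemma sigma_algebra_gen_sigma fs : sigma_algebra setT (gen_sigma fs).
Proof. exact: smallest_sigma_algebra. Qed.

Lemma gen_sigma_measurable fs :
  (forall f, fs f -> measurable_fun setT f) -> gen_sigma fs `<=` measurable.
Proof.
move=> mfs; apply: smallest_sub; first exact: sigma_algebra_measurable.
by move=> _ [f ff [A mA <-]]; rewrite -[X in measurable X]setTI; exact: mfs.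
Qed.

Lemma measurable_gen_sigma fs f : fs f ->
  @measurable_fun _ _ (g_sigma_algebraType (gen_sigma fs)) R setT f.
Proof.
move=> ff mT A mA; rewrite setTI; apply: sub_sigma_algebra.
by apply: sub_sigma_algebra; exists f => //; exists A.
Qed.

End GenSigma.

(** * Transfer of almost sure bounds and moments from sample 0 to all samples *)

Section EqualLawTransfer.
Import numFieldNormedType.Exports.
Context {dm : measure_display} {Omega : measurableType dm} {R : realType}
  {d : nat} (P : probability Omega R).
Implicit Types X Y : Omega -> 'rV[R]_d.

(** The ball is measurable for the box sigma-algebra, so its complement is null under both laws. *)
Lemma same_law_vec_ae_norm2 X Y r : measurable_vec X -> measurable_vec Y ->
  same_law_vec P X Y -> {ae P, forall w, norm2 (Y w) <= r} ->
  {ae P, forall w, norm2 (X w) <= r}.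
Proof.
move=> mX mY XY aeY.
pose V : set (g_sigma_algebraType (@boxes R d)) := [set v | norm2 v <= r].
have mV : measurable V.
  have := measurable_fun_ler (measurable_norm2 _ (@measurable_vec_id R d))
    (@measurable_cst _ _ _ R setT r).
  by move=> /(_ measurableT [set true] I); rewrite setTI.
have mpre Z : measurable_vec Z -> measurable (Z @^-1` (~` V)).
  move=> mZ; rewrite -[X in measurable X]setTI.
  by apply: measurable_borel_rV => //; exact: measurableC.
apply/negligibleP; first exact: mpre.
rewrite -[LHS]/(P (X @^-1` (~` V))) (same_law_vec_preimage P X Y (~` V))//;
  last exact: measurableC.
by apply: measure_negligible; [exact: mpre|exact: aeY].
Qed.

Lemma same_law_ae_norm (E F : Omega -> R) r :
  measurable_fun setT E -> measurable_fun setT F ->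
  same_law P E F -> {ae P, forall w, `|F w| <= r} ->
  {ae P, forall w, `|E w| <= r}.
Proof.
move=> mE mF EF aeF.
pose V : set R := [set e | `|e| <= r].
have mV : measurable V.
  have := measurable_fun_ler (@normr_measurable R setT)
    (@measurable_cst _ _ _ R setT r).
  by move=> /(_ measurableT [set true] I); rewrite setTI.
have mpre (Z : Omega -> R) : measurable_fun setT Z -> measurable (Z @^-1` (~` V)).
  move=> mZ; rewrite -[X in measurable X]setTI; apply: mZ => //.
  exact: measurableC.
apply/negligibleP; first exact: mpre.
rewrite -[LHS]/(P (E @^-1` (~` V))) EF; last exact: measurableC.
by apply: measure_negligible; [exact: mpre|exact: aeF].
Qed.

Lemma same_law_cutoff_mean X Y k : measurable_vec X -> measurable_vec Y ->
  same_law_vec P X Y ->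
  \int[P]_w unit_cutoff (X w) 0 k = \int[P]_w unit_cutoff (Y w) 0 k.
Proof.
move=> mX mY XY.
apply: (same_law_vec_Rintegral P X Y (fun v => unit_cutoff v 0 k) 1) => //.
  exact: (measurable_unit_cutoff _ measurable_vec_id).
by move=> v; rewrite (le_trans (norm2_coord _ _)) ?norm2_unit_cutoff.
Qed.

Lemma same_law_cutoff_cov X Y (m : 'rV[R]_d) k l :
  measurable_vec X -> measurable_vec Y -> same_law_vec P X Y ->
  \int[P]_w ((unit_cutoff (X w) - m) 0 k * (unit_cutoff (X w) - m) 0 l) =
  \int[P]_w ((unit_cutoff (Y w) - m) 0 k * (unit_cutoff (Y w) - m) 0 l).
Proof.
move=> mX mY XY; have mc := measurable_unit_cutoff _ (@measurable_vec_id R d).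
have mcm := measurable_vecB _ _ mc (measurable_vec_cst m).
have bc v q : `|(unit_cutoff v - m) 0 q| <= 1 + norm2 m.
  rewrite (le_trans (norm2_coord _ _))// (le_trans (norm2B _ _))//.
  by rewrite lerD2r norm2_unit_cutoff.
apply: (same_law_vec_Rintegral P X Y
  (fun v => (unit_cutoff v - m) 0 k * (unit_cutoff v - m) 0 l)
  ((1 + norm2 m) * (1 + norm2 m))) => //.
  exact: measurable_funM.
by move=> v; rewrite normrM ler_pM.
Qed.

Lemma expectation_ae_eq (f g : Omega -> R) :
  measurable_fun setT f -> measurable_fun setT g ->
  {ae P, forall w, f w = g w} -> 'E_P[f]%E = (\int[P]_w (g w)%:E)%E.
Proof.
move=> mf mg fg; rewrite unlock; apply: ae_eq_integral => //.
- exact/measurable_EFinP.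
- exact/measurable_EFinP.
- by apply: filterS fg => w -> _.
Qed.

End EqualLawTransfer.

Theorem theorem3 (R : realType) (dm : measure_display) (Omega : measurableType dm)
  (P : probability Omega R)
  (d : nat) (D sigma alpha rho : R) (T : nat) (wstar : 'rV[R]_d)
  (Xs : nat -> Omega -> 'rV[R]_d) (Es Bs : nat -> Omega -> R) :
  (0 < d)%N -> 0 < D -> 0 <= sigma -> 0 <= alpha < 1 -> 0 < rho ->
  (0 < T)%N -> ~~ odd T ->
  norm2 wstar <= D ->
  (* measurability of all sample variables *)
  (forall i, (i < 2 * T)%N ->
     (forall k, measurable_fun setT (fun w => Xs i w 0 k)) /\
     measurable_fun setT (Es i) /\ measurable_fun setT (Bs i)) ->
  (* the 2T triples (x_i, eps_i, b_i) are i.i.d., with x_i, eps_i, b_i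
     mutually independent *)
  mutually_independent P (fun ic : nat * 'I_3 => (ic.1 < 2 * T)%N)
    (fun ic => let: (i, c) := ic in
       if nat_of_ord c == 0%N then gen_sigma [set fun w => Xs i w 0 k | k in [set: 'I_d]]
       else if nat_of_ord c == 1%N then gen_sigma [set Es i]
       else gen_sigma [set Bs i]) ->
  (forall i, (i < 2 * T)%N ->
     same_law_vec P (Xs i) (Xs 0%N) /\ same_law P (Es i) (Es 0%N) /\
     same_law P (Bs i) (Bs 0%N)) ->
  (* distributional assumptions on (x, eps, b) *)
  {ae P, forall w, norm2 (Xs 0%N w) <= 1} ->
  (let m k := fine ('E_P[fun w => Xs 0%N w ord0 k])%E in
   let Sigma k l := fine ('E_P[fun w => ((Xs 0%N w ord0 k - m k) * (Xs 0%N w ord0 l - m l))%R])%E in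
   forall v : 'rV[R]_d,
     \sum_(k < d) \sum_(l < d) v 0 k * Sigma k l * v 0 l >= rho * dotv v v) ->
  {ae P, forall w, `|Es 0%N w| <= sigma} ->
  ('E_P[Es 0%N] = 0)%E ->
  P [set w | Bs 0%N w != 0] = alpha%:E ->
  let Ys i w := dotv wstar (Xs i w) + Es i w + Bs i w in
  let Rr := 6 * D + sigma in
  let lam := (1 - alpha) * rho in
  let wout w := wbar D Rr lam T (fun i => Xs i w)
                  (fun k => Xs (T + k)%N w) (fun k => Ys (T + k)%N w) in
  ('E_P[fun w => (norm2 (wout w - wstar) ^+ 2)%R] <=
    (72 * Rr ^+ 2 * (2 * ln (T%:R) + 1) / (((1 - alpha) * rho) ^+ 2 * T%:R))%:E)%E.

Proof.
move=> d_gt0 D0 sigma0 /andP[alpha0 alpha1] rho0 T0 evenT wsD mXEB indep laws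
  aeX Sig_rho aeE _ PB.
cbv zeta.
pose J0 (ic : nat * 'I_3) := (ic.1 < 2 * T)%N.
pose G (ic : nat * 'I_3) : set (set Omega) := let: (i, c) := ic in
  if nat_of_ord c == 0%N
  then gen_sigma [set fun w => Xs i w 0 k | k in [set: 'I_d]]
  else if nat_of_ord c == 1%N then gen_sigma [set Es i] else gen_sigma [set Bs i].
have mX i : (i < 2 * T)%N -> measurable_vec (Xs i) by case/mXEB.
have mE i : (i < 2 * T)%N -> measurable_fun setT (Es i) by case/mXEB => _ [].
have mB i : (i < 2 * T)%N -> measurable_fun setT (Bs i) by case/mXEB => _ [].
have T2 : (0 < 2 * T)%N by rewrite muln_gt0.
have Gsigma j : J0 j -> sigma_algebra setT (G j).
  case: j => i c _; rewrite /G; case: ifPn => _; last case: ifPn => _;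
    exact: sigma_algebra_gen_sigma.
have Gmeas j : J0 j -> G j `<=` measurable.
  case: j => i c iT; rewrite /G; case: ifPn => _; last case: ifPn => _;
    apply: gen_sigma_measurable => f.
  - by move=> [k _ <-]; exact: mX.
  - by move=> ->; exact: mE.
  - by move=> ->; exact: mB.
pose X i w := unit_cutoff (Xs i w).
pose E i w := phiR sigma (Es i w).
(* The range condition sits inside the almost sure event so that a countable intersection over all
   [i] can be taken later. *)
have aeXi i : {ae P, forall w, (i < 2 * T)%N -> Xs i w = X i w}.
  have [iT|iT] := boolP (i < 2 * T)%N; last exact: aeW.
  have [lawX _] := laws i iT.
  apply: filterS (same_law_vec_ae_norm2 P _ _ 1 (mX _ iT) (mX _ T2) lawX aeX) => w Xw _.
  by rewrite /X /unit_cutoff Xw.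
have aeEi i : {ae P, forall w, (i < 2 * T)%N -> Es i w = E i w}.
  have [iT|iT] := boolP (i < 2 * T)%N; last exact: aeW.
  have [_ [lawE _]] := laws i iT.
  apply: filterS (same_law_ae_norm P _ _ _ (mE _ iT) (mE _ T2) lawE aeE) => w Ew _.
  by rewrite /E phiR_id.
have mXc i : (i < 2 * T)%N -> measurable_vec (X i).
  by move=> iT; apply: measurable_unit_cutoff; exact: mX.
have mEc i : (i < 2 * T)%N -> measurable_fun setT (E i).
  by move=> iT; apply: measurable_phiR; exact: mE.
(* Mean and covariance come from the untruncated sample 0, as in the hypothesis on [Sigma]; the
   truncated samples are then shown to share them. *)
pose m : 'rV[R]_d := \row_k fine ('E_P[fun w => Xs 0%N w ord0 k])%E.
pose Sig k l := fine ('E_P[fun w => ((Xs 0%N w ord0 k - m ord0 k) *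
  (Xs 0%N w ord0 l - m ord0 l))%R])%E.
have Xmean i k : (i < 2 * T)%N -> \int[P]_w X i w 0 k = m 0 k.
  move=> iT; rewrite mxE (expectation_ae_eq _ _ (fun w => X 0%N w 0 k)).
  - by rewrite (same_law_cutoff_mean P (Xs i) (Xs 0%N))//;
      [exact: mX|exact: mX|case: (laws i iT)].
  - exact: mX.
  - exact: mXc.
  - by apply: filterS (aeXi 0%N) => w ->.
have Xcov i k l : (i < 2 * T)%N ->
    \int[P]_w ((X i w - m) 0 k * (X i w - m) 0 l) = Sig k l.
  move=> iT; rewrite /Sig.
  rewrite (expectation_ae_eq _ _ (fun w => (X 0%N w - m) 0 k * (X 0%N w - m) 0 l)).
  - by rewrite (same_law_cutoff_cov P (Xs i) (Xs 0%N))//;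
      [exact: mX|exact: mX|case: (laws i iT)].
  - by apply: measurable_funM; apply: measurable_funB => //; exact: mX.
  - have mXm := measurable_vecB _ _ (mXc _ T2) (measurable_vec_cst m).
    by apply: measurable_funM; exact: mXm.
  - by apply: filterS (aeXi 0%N) => w ->//; rewrite !mxE.
have gen i (c : 'I_3) f fs : G (i, c) = gen_sigma fs -> fs f ->
    @measurable_fun _ _ (g_sigma_algebraType (G (i, c))) R setT f.
  by move=> ->; exact: measurable_gen_sigma.
have PBi i : (i < 2 * T)%N -> P [set w | Bs i w != 0] = alpha%:E.
  move=> iT; have [_ [_ lawB]] := laws i iT; rewrite -PB.
  apply: (lawB [set b | b != 0]).
  rewrite (_ : [set b | _] = ~` [set 0]); first exact: measurableC.
  by apply/seteqP; split => b /= /eqP.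
have lt1 i : (i < T)%N -> (i < 2 * T)%N.
  by move=> iT; rewrite (leq_trans iT)// leq_pmull.
have lt2 i : (i < T)%N -> (T + i < 2 * T)%N.
  by move=> iT; rewrite mul2n -addnn ltn_add2l.
(* Stated for generic data because the squared error must be measurable for both the original and
   the truncated samples. *)
have merr (Z : nat -> Omega -> 'rV[R]_d) (F : nat -> Omega -> R) :
    (forall i, (i < 2 * T)%N -> measurable_vec (Z i)) ->
    (forall i, (i < 2 * T)%N -> measurable_fun setT (F i)) ->
    measurable_fun setT (fun w => norm2 (wbar D (6 * D + sigma)
      ((1 - alpha) * rho) T (fun i => Z i w) (fun k => Z (T + k)%N w)
      (fun k => dotv wstar (Z (T + k)%N w) + F (T + k)%N w + Bs (T + k)%N w)
      - wstar) ^+ 2).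
  move=> mZ mF; apply: measurable_funX; apply: measurable_norm2.
  apply: measurable_vecB; last exact: measurable_vec_cst.
  apply: (measurable_wbar _ _ _ _ Z (fun k => Z (T + k)%N) (fun k w =>
    dotv wstar (Z (T + k)%N w) + F (T + k)%N w + Bs (T + k)%N w)) => k kT.
  - by apply: mZ; exact: lt1.
  - by apply: mZ; exact: lt2.
  - apply: measurable_funD; last by apply: mB; exact: lt2.
    apply: measurable_funD; last by apply: mF; exact: lt2.
    by apply: measurable_dotv; [exact: measurable_vec_cst|apply: mZ; exact: lt2].
have rate := bounded_sgd_rate P d D sigma alpha rho T wstar X E Bs G m Sig
  Gsigma Gmeas indep (ltW D0) sigma0 alpha1 rho0 T0 wsD.
rewrite (expectation_ae_eq _ _ (fun w => norm2 (wbar D (6 * D + sigma)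
  ((1 - alpha) * rho) T (fun i => X i w) (fun k => X (T + k)%N w)
  (fun k => dotv wstar (X (T + k)%N w) + E (T + k)%N w + Bs (T + k)%N w)
  - wstar) ^+ 2)).
- apply: rate => //.
  + move=> i iT k; split; last first.
      by exists 1 => w; rewrite (le_trans (norm2_coord _ _)) ?norm2_unit_cutoff.
    apply: measurable_unit_cutoff => l.
    by apply: (gen i _ _ [set fun w => Xs i w 0 k | k in [set: 'I_d]]) => //; exists l.
  + by move=> i w _; exact: norm2_unit_cutoff.
  + move=> i iT; apply: measurable_phiR.
    by apply: (gen i _ _ [set Es i]).
  + by move=> i w iT; exact: normr_phiR.
  + by move=> i iT; apply: (gen i _ _ [set Bs i]).
  + move=> v; have := Sig_rho v; congr (_ <= _).
    by apply: eq_bigr => k _; apply: eq_bigr => l _; rewrite /Sig !mxE.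
- exact: merr.
- exact: merr.
- have aeXE : {ae P, forall w, forall i, (i < 2 * T)%N -> Xs i w = X i w /\ Es i w = E i w}.
    apply: ae_foralln => i; apply: filterS2 (aeXi i) (aeEi i) => w Xw Ew iT.
    by split; [exact: Xw|exact: Ew].
  apply: filterS aeXE => w XE; congr (norm2 (_ - _) ^+ 2).
  apply: eq_wbar => i iT.
  - by have [] := XE i (lt1 _ iT).
  - by have [] := XE _ (lt2 _ iT).
  - by have [-> ->] := XE _ (lt2 _ iT).
Qed.
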